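(* Let $N$ be a feed-forward network, $f\in\mathcal{V}_0(N)$ generic and $L$ a feed-forward lift of $N$. (i) If $L$ is a lift inside the first layer, then every bifurcation branch of $f$ on $L$ is lifted from $N$. (ii) If $L$ is a lift that creates new layers, then there is a bifurcation branch of $f$ on $L$ which is not lifted from $N$.
   Context: A network $N$ with $k$ edge types is a finite set of cells $C$ together with functions $\sigma_1,\dots,\sigma_k:C\to C$ ($\sigma_i(c)$ is the source of the unique edge of type $i$ targeting $c$); $|N|=|C|$. Networks represented by $(\sigma_i:C\to C)$ and $(\sigma_i':C'\to C')$ are equal if there is a bijection $\varphi:C\to C'$ with $\varphi\circ\sigma_i=\sigma_i'\circ\varphi$ for all $i$. A feed-forward network is a network whose cells can be partitioned into nonempty layers $C_0,\dots,C_m$ ($C_0$ is the first layer) such that $\sigma_i(c)=c$ for $c\in C_0$ and all $i$; $\sigma_i(C_j)\subseteq C_{j-1}$ for $1\le j\le m$ and all $i$; and for $0\le j\le m-1$ every $c\in C_j$ equals $\sigma_i(c')$ for some $c'\in C_{j+1}$ and some $i$. Feed-forward networks are assumed connected (as undirected graphs). A coloring is an equivalence relation $\bowtie$ on the cells; it is balanced if $c\bowtie c'$ implies $\sigma_i(c)\bowtie\sigma_i(c')$ for all $i$. The quotient network $N/\bowtie$ has the $\bowtie$-classes as cells and is represented by $\sigma_i^{\bowtie}([c]_{\bowtie})=[\sigma_i(c)]_{\bowtie}$. $L$ is a lift of $N$ if $N=L/\bowtie$ for some balanced coloring $\bowtie$ in $L$. For a feed-forward lift $L$ (layers $C'_0,\dots,C'_n$)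 of a feed-forward network $N$ (layers $C_0,\dots,C_m$): $L$ is a lift inside the layer $C_j$ if $m=n$, $|C'_j|\ne|C_j|$ and $|C'_i|=|C_i|$ for $i\ne j$; $L$ is a lift that creates $n-m$ new layers if $m<n$, $|C'_0|=\dots=|C'_{n-m}|=|C_0|$ and $|C'_{n-m+j}|=|C_j|$ for $1\le j\le m$. $\mathcal{V}(N)$ is the set of smooth $f:\mathbb{R}\times\mathbb{R}^k\times\mathbb{R}\to\mathbb{R}$, $(x_0,x_1,\dots,x_k,\lambda)\mapsto f$, with $f(0,\dots,0,\lambda)=0$ for all $\lambda$; $f_i=\partial f/\partial x_i$ at the origin. $\mathcal{V}_0(N)=\{f\in\mathcal{V}(N): f_0=0\}$. It depends only on $k$, so $\mathcal{V}_0(N)=\mathcal{V}_0(L)$. The vector field is $(f^N(x,\lambda))_c=f(x_c,x_{\sigma_1(c)},\dots,x_{\sigma_k(c)},\lambda)$ on $\mathbb{R}^{|N|}$. ''Generic'' means: there is an open dense subset $O$ of the space of possible values of the first and second order partial derivatives at the origin of elements of the class, such that the statement holds for every $f$ in the class whose derivatives lie in $O$. A domain is an interval $]-\lambda_0,0]$, $]-\lambda_0,\lambda_0[$ or $[0,\lambda_0[$ with $\lambda_0>0$. An equilibrium branch of $f$ on $N$ is a function $b:D\to\mathbb{R}^{|N|}$ on a domain $D$ with $b(0)=0$ and $f^N(b(\lambda),\lambda)=0$ for all $\lambda\in D$, which is smooth if $D=]-\lambda_0,\lambda_0[$, and continuous on $D$ and smooth on $D\setminus\{0\}$ if $D$ is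 one-sided. Branches are taken as germs: $b_1:D_1\to\mathbb{R}^{|N|}$ and $b_2:D_2\to\mathbb{R}^{|N|}$ are related if there is an open neighborhood $U$ of $0$ with $U\cap D_1\cap D_2\ne\{0\}$ and $b_1=b_2$ on $U\cap D_1\cap D_2$; germ equivalence is the transitive closure, and equivalent branches are identified. The bifurcation branches are the equilibrium branches different from the trivial branch $0$. A bifurcation branch $b$ of $f$ on $L$ is lifted from $N$ if there is a balanced coloring $\bowtie$ in $L$ with $N=L/\bowtie$ and $b\in\Delta_{\bowtie}$, i.e. $b(\lambda)\in\Delta_{\bowtie}=\{x: c\bowtie d\Rightarrow x_c=x_d\}$ for all $\lambda$ in the domain near $0$. *)

(* Defs.v *)
From mathcomp Require Import all_boot all_order all_algebra.
From mathcomp Require Import all_classical all_reals all_analysis.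
From Stdlib Require Import Relation_Operators.

Set Implicit Arguments.
Unset Strict Implicit.
Unset Printing Implicit Defensive.

Import Order.TTheory GRing.Theory Num.Theory.
Import numFieldNormedType.Exports.

Local Open Scope quotient_scope.
Local Open Scope classical_set_scope.
Local Open Scope ring_scope.

(* [src i c] is sigma_i(c), the source of the edge of type [i] targeting [c]. *)
Record network (k : nat) := Network {
  cell :> finType;
  src : 'I_k -> cell -> cell
}.

Definition network_eq k (N N' : network k) : Prop :=
  exists phi : N -> N',
    bijective phi /\ forall i c, phi (src i c) = src i (phi c).

Definition connected_network k (N : network k) : Prop :=
  forall c d : N,
    connect [rel x y : N | [exists i, (src i x == y) || (src i y == x)]] c d.

(* The partition of the cells into layers C_0, ..., C_m is given by the index
   [ell c] of the layer of [c], so that C_j = [layer ell j]. *)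
Definition layer k (N : network k) (ell : N -> nat) (j : nat) : {set N} :=
  [set c | ell c == j]%SET.

Definition feed_forward k (N : network k) (m : nat) (ell : N -> nat) : Prop :=
  [/\ (forall c, (ell c <= m)%N)
      /\ (forall j, (j <= m)%N -> layer ell j != finset.set0),
      forall i c, c \in layer ell 0 -> src i c = c,
      forall j i c, (1 <= j <= m)%N -> c \in layer ell j ->
        src i c \in layer ell j.-1,
      forall j c, (j < m)%N -> c \in layer ell j ->
        exists i, exists2 c', c' \in layer ell j.+1 & c = src i c'
    & connected_network N].

Definition balanced k (N : network k) (e : equiv_rel N) : Prop :=
  forall c d : N, e c d -> forall i, e (src i c) (src i d).

(* [quot_type Q] is the alias of the quotient type [Q] that carries its finType
   structure. The source map of the quotient is defined through representatives;
   [src_quotient] shows that for a balanced coloring it sends [c] to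
   [sigma_i(c)], independently of this choice. *)
Definition quotient_network k (N : network k) (e : equiv_rel N) : network k :=
  @Network k (quot_type {eq_quot e}) (fun i x => \pi_({eq_quot e}) (src i (repr x))).

Lemma src_quotient k (N : network k) (e : equiv_rel N) :
  balanced e -> forall i (c : N),
  @src k (quotient_network e) i (\pi_({eq_quot e}) c)
  = \pi_({eq_quot e}) (src i c).
Proof. by move=> be i c; apply/eqmodP/be/eqmodP; rewrite reprK. Qed.

Definition is_lift k (L N : network k) : Prop :=
  exists e : equiv_rel L, balanced e /\ network_eq N (quotient_network e).

Definition lift_inside_layer k (N L : network k) (m n : nat)
    (ell : N -> nat) (ell' : L -> nat) (j : nat) : Prop :=
  [/\ is_lift L N, m = n, #|layer ell' j| <> #|layer ell j|
    & forall i, (i <= m)%N -> i <> j -> #|layer ell' i| = #|layer ell i| ].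

Definition lift_creating_layers k (N L : network k) (m n : nat)
    (ell : N -> nat) (ell' : L -> nat) : Prop :=
  [/\ is_lift L N, (m < n)%N,
      forall i, (i <= n - m)%N -> #|layer ell' i| = #|layer ell 0|
    & forall j, (1 <= j <= m)%N ->
        #|layer ell' (n - m + j)| = #|layer ell j| ].

(* A function f(x_0, x_1, ..., x_k, lambda) is a function on 'rV[R]_k.+2:
   coordinate 0 is x_0, coordinate i (1 <= i <= k) is x_i and coordinate
   k.+1 is lambda. *)
Definition coord_vec (R : Type) k (x0 : R) (x : 'I_k -> R) (lam : R) :
    'rV[R]_k.+2 :=
  \row_j match unlift ord0 j with
         | None => x0
         | Some j' => match unlift ord_max j' with
                      | None => lam
                      | Some i => x i
                      end
         end.

Definition partial (R : realType) n (i : 'I_n.+1) (f : 'rV[R]_n.+1 -> R) :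
    'rV[R]_n.+1 -> R :=
  fun x => 'D_(delta_mx 0 i) f x.

Fixpoint class_C (R : realType) n (r : nat) (f : 'rV[R]_n.+1 -> R) : Prop :=
  match r with
  | 0 => continuous f
  | r'.+1 => (forall x, differentiable f x)
             /\ forall i, class_C r' (partial i f)
  end.

Definition smooth (R : realType) n (f : 'rV[R]_n.+1 -> R) : Prop :=
  forall r, class_C r f.

Definition classV (R : realType) k : set ('rV[R]_k.+2 -> R) :=
  [set f | smooth f /\ forall lam, f (coord_vec 0 (fun=> 0) lam) = 0].

Definition classV0 (R : realType) k : set ('rV[R]_k.+2 -> R) :=
  [set f | classV f /\ partial ord0 f 0 = 0].

Definition jet2 (R : realType) n (f : 'rV[R]_n.+1 -> R) :
    'rV[R]_n.+1 * 'M[R]_n.+1 :=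
  (\row_i partial i f 0, \matrix_(i, j) partial i (partial j f) 0).

Definition open_dense_in (T : topologicalType) (S O : set T) : Prop :=
  (exists2 U, open U & O = U `&` S) /\ S `<=` closure O.

Definition generic (R : realType) n (A : set ('rV[R]_n.+1 -> R))
    (P : ('rV[R]_n.+1 -> R) -> Prop) : Prop :=
  exists2 O, open_dense_in (@jet2 R n @` A) O
           & forall f, A f -> O (jet2 f) -> P f.

Definition vector_field (R : realType) k (f : 'rV[R]_k.+2 -> R)
    (N : network k) (x : N -> R) (lam : R) : N -> R :=
  fun c => f (coord_vec (x c) (fun i => x (src i c)) lam).

Definition one_sided (R : realType) (D : set R) : Prop :=
  exists2 l : R, 0 < l & D = `]- l, 0]%classic \/ D = `[0, l[%classic.

Definition two_sided (R : realType) (D : set R) : Prop :=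
  exists2 l : R, 0 < l & D = `]- l, l[%classic.

(* Meant for open [U]: the derivatives at [x] then depend only on the values of
   [g] on [U]. *)
Definition smooth_on (R : realType) (U : set R) (g : R -> R) : Prop :=
  forall r x, U x -> derivable (derive1n r g) x 1.

(* Only the values of [bfun] on [bdom] are meaningful. *)
Record branch (R : realType) k (N : network k) := Branch {
  bdom : set R;
  bfun :> R -> N -> R
}.

Definition equilibrium_branch (R : realType) k (f : 'rV[R]_k.+2 -> R)
    (N : network k) (b : branch R N) : Prop :=
  [/\ (two_sided (bdom b) /\ forall c, smooth_on (bdom b) (b ^~ c))
      \/ (one_sided (bdom b) /\ forall c,
            {within bdom b, continuous (b ^~ c)}
            /\ smooth_on (bdom b `\ 0) (b ^~ c)),
      forall c, b 0 c = 0
    & forall lam, bdom b lam -> forall c, vector_field f (b lam) lam c = 0].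

Definition related (R : realType) k (f : 'rV[R]_k.+2 -> R) (N : network k)
    (b1 b2 : branch R N) : Prop :=
  [/\ equilibrium_branch f b1, equilibrium_branch f b2
    & exists U : set R, [/\ open_nbhs 0 U,
        U `&` bdom b1 `&` bdom b2 <> [set 0]
      & forall lam, (U `&` bdom b1 `&` bdom b2) lam -> b1 lam = b2 lam]].

Definition germ_equiv (R : realType) k (f : 'rV[R]_k.+2 -> R)
    (N : network k) : branch R N -> branch R N -> Prop :=
  clos_trans _ (@related R k f N).

Definition trivial_branch (R : realType) k (N : network k) : branch R N :=
  @Branch R k N `]-1, 1[%classic (fun _ _ => 0).

Definition bifurcation_branch (R : realType) k (f : 'rV[R]_k.+2 -> R)
    (N : network k) (b : branch R N) : Prop :=
  equilibrium_branch f b /\ ~ germ_equiv f b (trivial_branch R N).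

Definition lifted_from (R : realType) k (N L : network k) (b : branch R L) :
    Prop :=
  exists e : equiv_rel L,
    [/\ balanced e, network_eq N (quotient_network e)
      & \forall lam \near (0 : R), bdom b lam ->
          forall c d : L, e c d -> b lam c = b lam d].

(* Main.v *)
(* For generic [f] put S = f_1 + ... + f_k, A = f_00, B = f_0lambda, all nonzero.

   A first-layer cell satisfies f(x, ..., x, lambda) = 0, whose x-derivative at the
   origin is S, so x = 0 near the origin. If only the first layer changes size, counting
   cells downwards from the top layer shows that the quotient map L -> N preserves
   layers and is injective on all but the first one; hence every branch is constant on
   its fibers.

   If L creates n - m > 0 layers, a cell of layer 1 of L cannot be mapped above the
   first layer of N, since otherwise its n - 1 >= m successive layers above it would
   give too many layers of N; so it is identified with its sources. It remains to find
   a branch that is nonzero on layer 1. We look for x_c = y_j for c in layer j, with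
   y_0 = 0 and f(y_(j+1), y_j, ..., y_j, lambda) = 0. To leading order this reads
   A y_1 / 2 + B lambda = 0 for j = 0 and A y_(j+1)^2 / 2 + S y_j = 0 for j >= 1, which
   is solvable on one side of lambda = 0 if all y_j with j >= 1 have the sign of - S A. *)
Require Import Defs.
From mathcomp Require Import all_boot all_order all_algebra.
From mathcomp Require Import all_classical all_reals all_analysis.
From mathcomp Require Import ring lra zify.

Set Implicit Arguments.
Unset Strict Implicit.
Unset Printing Implicit Defensive.

Import Order.TTheory GRing.Theory Num.Theory.
Import numFieldNormedType.Exports.

Local Open Scope classical_set_scope.
Local Open Scope ring_scope.

(** * Smooth functions of several variables *)

Section ClassC.
Variables (R : realType) (n : nat).
Implicit Types (f g : 'rV[R]_n.+1 -> R) (v : 'rV[R]_n.+1).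

Lemma derive_partial f v x : differentiable f x ->
  'D_v f x = \sum_i v 0 i * partial i f x.
Proof.
move=> df; rewrite deriveE// {1}[v]row_sum_delta linear_sum.
by apply: eq_bigr => i _; rewrite linearZ /partial deriveE.
Qed.

Lemma class_C_continuous r f : class_C r f -> continuous f.
Proof.
by case: r => // r [df _] x; exact/differentiable_continuous/df.
Qed.

Lemma class_CW r f : class_C r.+1 f -> class_C r f.
Proof.
elim: r f => [|r IHr] f; first exact: class_C_continuous.
by move=> [df Cf]; split => // i; apply/IHr/Cf.
Qed.

Lemma class_C_cst r (a : R) : class_C r (cst a : 'rV[R]_n.+1 -> R).
Proof.
elim: r a => [|r IHr] a; first exact: cst_continuous.
split=> [x|i]; first exact: differentiable_cst.
have -> : partial i (cst a : 'rV[R]_n.+1 -> R) = cst 0; last exact: IHr.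
by apply/funext => x; rewrite /partial derive_cst.
Qed.

Lemma class_CD r f g : class_C r f -> class_C r g -> class_C r (f + g).
Proof.
elim: r f g => [|r IHr] f g; first by move=> cf cg x; exact: cvgD (cf x) (cg x).
move=> [df Cf] [dg Cg]; split=> [x|i]; first exact: differentiableD.
have -> : partial i (f + g) = partial i f + partial i g; last first.
  apply: IHr; [exact: Cf|exact: Cg].
by apply/funext => x; rewrite /partial deriveD//; exact: diff_derivable.
Qed.

Lemma class_CM r f g : class_C r f -> class_C r g -> class_C r (f * g).
Proof.
elim: r f g => [|r IHr] f g; first by move=> cf cg x; exact: cvgM (cf x) (cg x).
move=> Cf1 Cg1; have [[df Cf] [dg Cg]] := (Cf1, Cg1).
split=> [x|i]; first exact: differentiableM.
have -> : partial i (f * g) = f * partial i g + g * partial i f.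
  by apply/funext => x; rewrite /partial deriveM//; exact: diff_derivable.
by apply: class_CD; apply: IHr; do ?[exact: class_CW|exact: Cf|exact: Cg].
Qed.

Lemma partial_coord i j :
  partial i (fun x : 'rV[R]_n.+1 => x 0 j) = cst ((i == j)%:R).
Proof.
apply/funext => x; have /matrixP/(_ 0 j) :=
  derive_mx (@derivable_id _ 'rV[R]_n.+1 x (delta_mx 0 i)).
rewrite derive_id.
by rewrite !mxE eqxx /= eq_sym.
Qed.

Lemma smoothD f g : smooth f -> smooth g -> smooth (f + g).
Proof. by move=> Sf Sg r; exact: class_CD. Qed.

Lemma smoothM f g : smooth f -> smooth g -> smooth (f * g).
Proof. by move=> Sf Sg r; exact: class_CM. Qed.

Lemma smooth_cst (a : R) : smooth (cst a : 'rV[R]_n.+1 -> R).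
Proof. by move=> r; exact: class_C_cst. Qed.

Lemma smooth_sum (I : Type) (s : seq I) (F : I -> 'rV[R]_n.+1 -> R) :
  (forall i, smooth (F i)) -> smooth (\sum_(i <- s) F i).
Proof.
move=> SF; elim/big_ind : _ => //; last exact: smoothD.
exact: smooth_cst.
Qed.

Lemma smooth_partial f i : smooth f -> smooth (partial i f).
Proof. by move=> Sf r; exact: (Sf r.+1).2. Qed.

Lemma smooth_differentiable f x : smooth f -> differentiable f x.
Proof. by move=> Sf; exact: (Sf 1).1. Qed.

Lemma smooth_continuous f : smooth f -> continuous f.
Proof. by move=> Sf; exact: (Sf 0). Qed.

Lemma smooth_derive f v : smooth f -> smooth ('D_v f).
Proof.
move=> Sf; have -> : 'D_v f = \sum_i cst (v 0 i) * partial i f.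
  by apply/funext => x; rewrite derive_partial ?fct_sumE//; exact: smooth_differentiable.
by apply: smooth_sum => i; apply: smoothM; [exact: smooth_cst|exact: smooth_partial].
Qed.

End ClassC.

(** * Smooth functions of one variable and curves *)

Section Cr.
Variable R : realType.
Implicit Types (U : set R) (g h : R -> R).

(** Differentiability [r] times on [U], with the derivative supplied as a witness, so that sums,
    products and inverses are handled by induction on [r]. Continuity of the last derivative is not
    demanded; having the property for all [r] amounts to smoothness. *)
Fixpoint Cr_on (r : nat) U g : Prop :=
  if r is r'.+1 then
    exists2 g', (forall x, U x -> is_derive x 1 g (g' x)) & Cr_on r' U g'
  else True.

Lemma Cr_on_eq r U g h : open U -> (forall x, U x -> g x = h x) ->
  Cr_on r U g -> Cr_on r U h.
Proof.
case: r => // r oU gh [g' gg' Cg']; exists g' => // x Ux.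
apply: near_eq_is_derive (gg' x Ux).
by apply: filterS (open_nbhs_nbhs (conj oU Ux)) => t; exact: gh.
Qed.

Lemma Cr_on_sub r U V g : V `<=` U -> Cr_on r U g -> Cr_on r V g.
Proof.
move=> VU; elim: r g => // r IHr g [g' gg' /IHr Cg'].
by exists g' => // x /VU; exact: gg'.
Qed.

Lemma Cr_onW r U g : Cr_on r.+1 U g -> Cr_on r U g.
Proof.
elim: r g => // r IHr g [g' gg' Cg'].
by exists g' => //; apply: IHr.
Qed.

(** On an open set the witness agrees with [derive1], so the iterated derivatives can be replaced by
    the witnesses one at a time. *)
Lemma Cr_on_smooth U g : open U -> (forall r, Cr_on r U g) -> smooth_on U g.
Proof.
move=> oU Cg r x Ux; move: (Cg r.+1); elim: r g {Cg} => [|r IHr] g [g' gg' Cg'].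
  by have [] := gg' x Ux.
rewrite derive1Sn; apply: IHr; apply: (@Cr_on_eq r.+1 U g') => // t Ut.
by rewrite derive1E; have [_ ->] := gg' t Ut.
Qed.

Lemma Cr_on_cst r U (a : R) : Cr_on r U (cst a).
Proof.
elim: r a => // r IHr a; exists (cst 0); last exact: IHr.
by move=> x _; exact: is_derive_cst.
Qed.

Lemma Cr_onD r U g h : Cr_on r U g -> Cr_on r U h -> Cr_on r U (g + h).
Proof.
elim: r g h => // r IHr g h [g' gg' Cg'] [h' hh' Ch'].
exists (g' + h'); last exact: IHr.
by move=> x Ux; have ? := gg' x Ux; have ? := hh' x Ux; exact: is_deriveD.
Qed.

Lemma Cr_onM r U g h : Cr_on r U g -> Cr_on r U h -> Cr_on r U (g * h).
Proof.
elim: r g h => // r IHr g h Cg1 Ch1; have [g' gg' Cg'] := Cg1.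
have [h' hh' Ch'] := Ch1; exists (g * h' + h * g').
  by move=> x Ux; have ? := gg' x Ux; have ? := hh' x Ux; exact: is_deriveM.
by apply: Cr_onD; apply: IHr => //; exact: Cr_onW.
Qed.

Lemma Cr_onN r U g : Cr_on r U g -> Cr_on r U (- g).
Proof.
have -> : - g = cst (-1) * g by apply/funext => x; rewrite !fctE mulN1r.
by apply: Cr_onM; exact: Cr_on_cst.
Qed.

Lemma Cr_onV r U g : (forall x, U x -> g x != 0) ->
  Cr_on r U g -> Cr_on r U (fun x => (g x)^-1).
Proof.
move=> g0; elim: r => // r IHr Cg; have [g' gg' Cg'] := Cg.
have CV := IHr (Cr_onW Cg).
exists (- ((fun x => (g x)^-1) * (fun x => (g x)^-1) * g')).
  move=> x Ux; have [dg eg] := gg' x Ux; have gx0 := g0 x Ux.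
  apply: DeriveDef; first exact: derivableV.
  by rewrite deriveV// eg !fctE expr2 invfM scaleNr.
by apply: Cr_onN; apply: Cr_onM => //; exact: Cr_onM.
Qed.

Lemma Cr_on_scale r U V g (e : R) : (forall x, V x -> U (e * x)) ->
  Cr_on r U g -> Cr_on r V (fun x => g (e * x)).
Proof.
move=> VU; elim: r g => // r IHr g [g' gg' Cg'].
exists ((fun x => g' (e * x)) * cst e); last first.
  by apply: Cr_onM; [exact: IHr|exact: Cr_on_cst].
move=> x Vx; have ? := gg' _ (VU x Vx).
apply: (@is_derive1_comp _ g ( *%R e)); rewrite -[X in is_derive _ _ _ X]mulr1.
exact: is_deriveZ.
Qed.

End Cr.

Section Curve.
Variables (R : realType) (n : nat).
Implicit Types (f : 'rV[R]_n.+1 -> R) (a b c : 'rV[R]_n.+1) (y z : R -> R).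

Lemma is_derive_scalel y a (x dy : R) : is_derive x 1 y dy ->
  is_derive x 1 (fun t => y t *: a) (dy *: a).
Proof.
move=> [/derivable1_diffP dfy <-]; apply: DeriveDef.
  by apply/derivable1_diffP; exact: differentiableZl.
by rewrite !deriveE ?diffZl//; exact: differentiableZl.
Qed.

Lemma is_derive_curve f (g : R -> 'rV[R]_n.+1) (x : R) dg : differentiable f (g x) ->
  is_derive x 1 g dg -> is_derive x 1 (f \o g) ('D_dg f (g x)).
Proof.
move=> df [/derivable1_diffP dfg <-]; apply: DeriveDef.
  exact/derivable1_diffP/differentiable_comp.
rewrite [LHS]deriveE; last exact: differentiable_comp.
by rewrite diff_comp// [RHS]deriveE// /= [in RHS]deriveE.
Qed.

(** Up to signs, [a] will be the direction of the internal variable, [b] the common direction of all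
    source variables and [c] that of the parameter: [z] is the state of a cell and [y] that of its
    sources. *)
Definition curve a b c z y (t : R) : 'rV[R]_n.+1 := z t *: a + y t *: b + t *: c.

Lemma is_derive_along f a b c z y (x dz dy : R) : differentiable f (curve a b c z y x) ->
  is_derive x 1 z dz -> is_derive x 1 y dy ->
  is_derive x 1 (f \o curve a b c z y)
    (dz * 'D_a f (curve a b c z y x) + dy * 'D_b f (curve a b c z y x)
     + 'D_c f (curve a b c z y x)).
Proof.
move=> df dz' dy'.
have /(is_derive_curve df) : is_derive x 1 (curve a b c z y) (dz *: a + dy *: b + c).
  rewrite -[X in _ + X]scale1r.
  apply: is_deriveD; last by apply: is_derive_scalel; exact: is_derive_id.
  by apply: is_deriveD; exact: is_derive_scalel.
by rewrite !deriveE// !linearD !linearZ.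
Qed.

(** By the chain rule the derivative is built from [z'], [y'] and directional derivatives of [f]
    along the same curve; these are smooth again, so the induction on [r] runs over all [f]. *)
Lemma Cr_on_along r U f a b c z y : smooth f -> Cr_on r U z -> Cr_on r U y ->
  Cr_on r U (f \o curve a b c z y).
Proof.
elim: r f => // r IHr f Sf Cz Cy; have [z' zz' Cz'] := Cz.
have [y' yy' Cy'] := Cy.
exists (z' * ('D_a f \o curve a b c z y) + y' * ('D_b f \o curve a b c z y)
     + ('D_c f \o curve a b c z y)).
  move=> x Ux; apply: is_derive_along; [exact: smooth_differentiable|exact: zz'|exact: yy'].
move: Cz Cy => /Cr_onW Cz /Cr_onW Cy.
by do !apply: Cr_onD; try apply: Cr_onM => //; apply: IHr => //; exact: smooth_derive.
Qed.

End Curve.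

(** * Convex functions and mean values *)

Section RealLemmas.
Variable R : realType.
Implicit Types g : R -> R.

Lemma mvt_lt g dg (a b : R) : a < b -> (forall x : R, is_derive x 1 g (dg x)) ->
  exists2 c, a < c < b & g b - g a = dg c * (b - a).
Proof.
move=> ab dgP; have [|c] := MVT ab (fun x _ => dgP x).
  apply: derivable_within_continuous => x _.
  by have [] := dgP x.
by rewrite in_itv /= => cab E; exists c.
Qed.

Lemma cvg_is_derive g (x d : R) :
  h^-1 * (g (x + h) - g x) @[h --> 0^'] --> d -> is_derive x 1 g d.
Proof.
have E : (fun h : R => h^-1 * (g (x + h) - g x)) =
         (fun h => h^-1 *: ((g \o shift x) (h *: 1) - g x)).
  by apply/funext => h; rewrite /= [h%:A]mulr1 [h + x]addrC.
rewrite E => gd; apply: DeriveDef; first by apply/cvg_ex; exists d.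
exact/cvg_lim.
Qed.

Lemma is_derive_cvg g (x d : R) : is_derive x 1 g d ->
  h^-1 * (g (x + h) - g x) @[h --> 0^'] --> d.
Proof.
move=> [dg <-]; have E : (fun h : R => h^-1 * (g (x + h) - g x)) =
         (fun h => h^-1 *: ((g \o shift x) (h *: 1) - g x)).
  by apply/funext => h; rewrite /= [h%:A]mulr1 [h + x]addrC.
by rewrite E; exact: dg.
Qed.

(** Brackets a zero [x] by two points where the sign of the function is known; this yields
    continuity of an implicitly defined zero. *)
Lemma sandwich (x d e : R) : 0 < x < d -> 0 < e ->
  exists w1 w2, [/\ 0 < w1 < d, w1 < x, x < w2, 0 < w2 < d &
    forall y, w1 < y -> y < w2 -> `|x - y| < e].
Proof.
move=> /andP[x0 xd] e0; exists (Num.max (x / 2) (x - e / 2)).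
exists (Num.min ((x + d) / 2) (x + e / 2)).
case: (leP (x / 2) (x - e / 2)) => ?; case: (leP ((x + d) / 2) (x + e / 2)) => ?.
all: split=> [|||| y ? ?]; rewrite ?ltr_distl; try (apply/andP; split); lra.
Qed.

Lemma half_ratio (A B : R) : A != 0 -> - B / A / 2 * A + B = B / 2.
Proof. by move=> A0; field. Qed.

Lemma convex_pos g g1 g2 (d w : R) :
    (forall x : R, is_derive x 1 g (g1 x)) ->
    (forall x : R, is_derive x 1 g1 (g2 x)) ->
    (forall x, 0 <= x <= d -> 0 < g2 x) ->
  g 0 = 0 -> g1 0 = 0 -> 0 < w <= d -> 0 < g w.
Proof.
move=> gg1 g1g2 g2_gt0 g0 g10 /andP[w0 wd].
have [t /andP[t0 tw]] := mvt_lt w0 gg1; rewrite g0 !subr0 => ->.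
have [s /andP[s0 st]] := mvt_lt t0 g1g2; rewrite g10 !subr0 => ->.
by rewrite !mulr_gt0// g2_gt0//; apply/andP; split; lra.
Qed.

(** The intermediate value theorem gives the zero in []p, d[]. Since [g1] is strictly increasing on
    [[0, d]], mean slopes over successive intervals increase; a wrong sign of [g] at [w] would give
    a nonnegative slope followed by a nonpositive one. *)
Lemma convex_zero g g1 g2 (d p : R) :
    (forall x : R, is_derive x 1 g (g1 x)) ->
    (forall x : R, is_derive x 1 g1 (g2 x)) ->
    (forall x, 0 <= x <= d -> 0 < g2 x) ->
    g 0 <= 0 -> 0 <= p < d -> g p < 0 -> 0 < g d ->
  exists z, [/\ 0 < z < d, g z = 0, 0 < g1 z,
    (forall w, 0 < w < z -> g w < 0) & (forall w, z < w <= d -> 0 < g w)].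
Proof.
move=> gg1 g1g2 g2_gt0 g0 /andP[p0 pd] gp gd.
have g1_incr x y : 0 <= x -> x < y -> y <= d -> g1 x < g1 y.
  move=> x0 xy yd; have [c /andP[xc cy] E] := mvt_lt xy g1g2.
  by rewrite -subr_gt0 E mulr_gt0 ?subr_gt0// g2_gt0//; apply/andP; split; lra.
have gc : {within `[p, d], continuous g}.
  by apply: derivable_within_continuous => x _; have [] := gg1 x.
have [|z] := @IVT R g p d 0 (ltW pd) gc.
  by rewrite minEle maxEle (ltW (lt_trans gp gd)) !ltW.
rewrite in_itv /= => /andP[pz zd] gz.
have {}pz : p < z by rewrite lt_neqAle pz andbT; apply: contraTN gp => /eqP ->; rewrite gz ltxx.
have {}zd : z < d by rewrite lt_neqAle zd andbT; apply: contraTN gd => /eqP <-; rewrite gz ltxx.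
exists z; split => //.
- by apply/andP; split; lra.
- have [c /andP[pc cz]] := mvt_lt pz gg1; rewrite gz sub0r => E.
  have : 0 < g1 c by rewrite -(pmulr_lgt0 _ (_ : 0 < z - p)) ?subr_gt0// -E oppr_gt0.
  by move/lt_trans; apply; apply: g1_incr => //; lra.
- move=> w /andP[w0 wz]; rewrite ltNge; apply/negP => gw.
  have [c1 /andP[c10 c1w] E1] := mvt_lt w0 gg1.
  have [c2 /andP[c2w c2z] E2] := mvt_lt wz gg1.
  have : 0 <= g1 c1.
    by rewrite -(pmulr_lge0 _ (_ : 0 < w - 0)) ?subr_gt0// -E1; lra.
  have : g1 c2 <= 0.
    by rewrite -(pmulr_lle0 _ (_ : 0 < z - w)) ?subr_gt0// -E2 gz; lra.
  have : g1 c1 < g1 c2 by apply: g1_incr; lra.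
  by lra.
- move=> w /andP[zw wd]; rewrite ltNge; apply/negP => gw.
  have z0 : 0 < z by lra.
  have [c1 /andP[c10 c1w] E1] := mvt_lt z0 gg1.
  have [c2 /andP[c2w c2z] E2] := mvt_lt zw gg1.
  have : 0 <= g1 c1.
    by rewrite -(pmulr_lge0 _ (_ : 0 < z - 0)) ?subr_gt0// -E1 gz; lra.
  have : g1 c2 <= 0.
    by rewrite -(pmulr_lle0 _ (_ : 0 < w - z)) ?subr_gt0// -E2 gz; lra.
  have : g1 c1 < g1 c2 by apply: g1_incr; lra.
  by lra.
Qed.

End RealLemmas.

(** * Mean values and neighborhoods along lines *)

Section Implicit.
Variables (R : realType) (n : nat).
Implicit Types (f : 'rV[R]_n.+1 -> R) (a b c v : 'rV[R]_n.+1) (y z : R -> R).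

Lemma is_derive_line f a v (x : R) : smooth f ->
  is_derive x 1 (fun s => f (s *: a + v)) ('D_a f (x *: a + v)).
Proof.
move=> Sf; have Sfx := smooth_differentiable (x *: a + v) Sf.
apply: (@is_derive_curve _ _ f (fun s => s *: a + v)) => //.
rewrite -[X in is_derive _ _ _ X]addr0 -[X in X + _]scale1r.
by apply: is_deriveD; apply: is_derive_scalel; exact: is_derive_id.
Qed.

(** The intermediate point is given as a fraction [t] of the increment, so that [s] may have any
    sign or vanish. *)
Lemma mvt_line f a v (s : R) : smooth f ->
  exists2 t, 0 < t < 1 & f (s *: a + v) - f v = s * 'D_a f ((t * s) *: a + v).
Proof.
move=> Sf; pose g t := f (t *: (s *: a) + v).
have dg (t : R) : is_derive t 1 g ('D_(s *: a) f (t *: (s *: a) + v)).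
  exact: is_derive_line.
have [t t01] := mvt_lt (@ltr01 R) dg.
rewrite /g scale1r scale0r add0r subr0 mulr1 => ->; exists t => //.
rewrite scalerA !deriveE ?linearZ//; exact: smooth_differentiable.
Qed.

Lemma nbhs_line (W : set 'rV[R]_n.+1) a (s0 : R) v0 : nbhs (s0 *: a + v0) W ->
  exists2 d, 0 < d &
    \forall v \near v0, forall s, `|s - s0| <= d -> W (s *: a + v).
Proof.
move=> nW; have : continuous (fun q : R * 'rV[R]_n.+1 => q.1 *: a + q.2).
  move=> q; apply: cvgD; last exact: cvg_snd.
  by apply: cvgZr_tmp; exact: cvg_fst.
move=> /(_ (s0, v0) W nW) [[P Q] /= [+ nQ] sub].
(* Half the radius: the closed interval of radius [d] has to fit into the open ball. *)
move=> /nbhs_ballP[e /= e0 eP]; exists (e / 2); first by rewrite divr_gt0.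
apply: filterS nQ => v Qv s sd; apply: (sub (s, v)); split => //; apply: eP.
by rewrite /ball /= distrC (le_lt_trans sd)// ltr_pdivrMr// ltr_pMr// ltr1n.
Qed.

End Implicit.

(** * Branches of implicit functions *)

Section ImplicitBranch.
Variables (R : realType) (n : nat).
Implicit Types (f : 'rV[R]_n.+1 -> R) (a b c v : 'rV[R]_n.+1) (y z : R -> R).

Lemma cvg_shift_dnbhs0 (T : topologicalType) (g : R -> T) (x : R) (l : T) :
  g t @[t --> x] --> l -> g (x + h) @[h --> 0^'] --> l.
Proof.
move=> gl; apply: (cvg_comp _ _ _ gl); apply: cvg_trans (_ : (x + h) @[h --> (0:R)] --> x).
  by apply: cvg_app; exact: cvg_within.
by rewrite -[X in _ --> X]addr0; apply: cvgD; [exact: cvg_cst|exact: cvg_id].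
Qed.

Lemma continuous_curve a b c z y (x : R) :
  {for x, continuous z} -> {for x, continuous y} ->
  {for x, continuous (curve a b c z y)}.
Proof.
move=> cz cy; apply: cvgD; last by apply: cvgZr_tmp; exact: cvg_id.
by apply: cvgD; apply: cvgZr_tmp.
Qed.

(** Only continuity of [z] is assumed. Let [phi] be [f] along the curve with [z] frozen at [z x].
    The mean value theorem in direction [a] gives [- phi t = (z t - z x) * q t] near [x], where
    [q t] tends to [D_a f]; dividing by [t - x] gives the derivative of [z] as
    [- phi' x / D_a f]. *)
Lemma implicit_derive f a b c z y (x dy : R) : smooth f ->
    {for x, continuous z} -> is_derive x 1 y dy ->
    (\forall t \near x, f (curve a b c z y t) = 0) ->
    'D_a f (curve a b c z y x) != 0 ->
  is_derive x 1 z (- (dy * 'D_b f (curve a b c z y x) + 'D_c f (curve a b c z y x))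
                   * ('D_a f (curve a b c z y x))^-1).
Proof.
move=> Sf cz dy' f0 Da0; set Da := 'D_a f _; set Db := 'D_b f _; set Dc := 'D_c f _.
pose u := curve a b c (cst (z x)) y; pose phi := f \o u.
have cy : {for x, continuous y}.
  by apply/differentiable_continuous/derivable1_diffP; have [] := dy'.
have cu : {for x, continuous u} by apply: continuous_curve => //; exact: cst_continuous.
have dphi : is_derive x 1 phi (dy * Db + Dc).
  have Sfx := smooth_differentiable (u x) Sf.
  have := is_derive_along Sfx (is_derive_cst (z x) x 1) dy'.
  by rewrite mul0r add0r.
have curveE t : curve a b c z y t = (z t - z x) *: a + u t.
  by rewrite /u /curve /= !addrA -scalerDl subrK.
have /choice[th thP] : forall t, exists s : R, 0 < s < 1 /\
    f (curve a b c z y t) - phi t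
    = (z t - z x) * 'D_a f ((s * (z t - z x)) *: a + u t).
  move=> t; have [s ? ?] := mvt_line a (u t) (z t - z x) Sf.
  by exists s; rewrite curveE.
pose q t := 'D_a f ((th t * (z t - z x)) *: a + u t).
have q_cvg : q t @[t --> x] --> Da.
  move=> W nW; have /(nbhs_line (s0 := 0)) : nbhs (0 *: a + u x) ('D_a f @^-1` W).
    by apply: smooth_continuous; [exact: smooth_derive|rewrite scale0r add0r].
  move=> [d d0 nu]; have near_u : \forall t \near x, forall s, `|s - 0| <= d ->
    W ('D_a f (s *: a + u t)) := cu _ nu.
  have near_z : \forall t \near x, `|z x - z t| < d by move/cvgrPdist_lt: cz; exact.
  suff : \forall t \near x, W (q t) by [].
  near=> t; apply: (near near_u t) => //.
  have [/andP[th0 th1] _] := thP t.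
  rewrite subr0 normrM gtr0_norm// (@le_trans _ _ (1 * `|z t - z x|))//.
    by apply: ler_wpM2r => //; exact: ltW.
  by rewrite mul1r distrC; apply: ltW; near: t.
have q0 : \forall t \near x, q t != 0.
  apply: (q_cvg [set r : R | r != 0]); apply: open_nbhs_nbhs.
  by split; [exact: open_neq|].
have f0x : f (curve a b c z y x) = 0 := nbhs_singleton f0.
apply: cvg_is_derive.
have -> : - (dy * Db + Dc) * Da^-1 = - ((dy * Db + Dc) * Da^-1) by rewrite mulNr.
apply: (@cvg_trans _ (- (h^-1 * (phi (x + h) - phi x) * (q (x + h))^-1) @[h --> 0^'])); last first.
  apply: cvgN; apply: cvgM; first exact: is_derive_cvg.
  by apply: cvgV => //; exact: cvg_shift_dnbhs0.
apply: near_eq_cvg.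
have shift_near (P : R -> Prop) : (\forall t \near x, P t) -> \forall h \near 0^', P (x + h).
  by move=> nP; exact: (@cvg_shift_dnbhs0 _ id x x cvg_id P nP).
near=> h.
have qh : q (x + h) != 0 by near: h; apply: shift_near q0.
have fh : f (curve a b c z y (x + h)) = 0 by near: h; apply: shift_near f0.
have [_] := thP (x + h); rewrite fh sub0r -/(q _) => E.
have -> : phi x = 0 by rewrite -f0x.
have {}E : phi (x + h) = - ((z (x + h) - z x) * q (x + h)) by rewrite -E opprK.
by rewrite subr0 E mulrN mulNr opprK -!mulrA mulfV// mulr1.
Unshelve. all: by end_near. Qed.

Lemma near_gt0 (T : topologicalType) (g : T -> R) x :
  {for x, continuous g} -> 0 < g x -> \forall t \near x, 0 < g t.
Proof.
move=> cg g0; apply: (cg [set r | 0 < r]); apply: open_nbhs_nbhs.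
by split; [exact: open_gt|].
Qed.

Lemma near_lt0 (T : topologicalType) (g : T -> R) x :
  {for x, continuous g} -> g x < 0 -> \forall t \near x, g t < 0.
Proof.
move=> cg g0; apply: (cg [set r | r < 0]); apply: open_nbhs_nbhs.
by split; [exact: open_lt|].
Qed.

Lemma near_neq0 (T : topologicalType) (g : T -> R) x :
  {for x, continuous g} -> g x != 0 -> \forall t \near x, g t != 0.
Proof.
move=> cg g0; apply: (cg [set r | r != 0]); apply: open_nbhs_nbhs.
by split; [exact: open_neq|].
Qed.

(* Extending by [0] to [t <= 0] makes continuity on [[0, l[] plain continuity. *)
Definition right_branch (l : R) y : Prop :=
  [/\ forall t, t < l -> {for t, continuous y}, forall t, t <= 0 -> y t = 0
    & forall r, Cr_on r `]0, l[%classic y].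

Lemma right_branchW (l l' : R) y : l' <= l -> right_branch l y -> right_branch l' y.
Proof.
move=> l'l [cy y0 Cy]; split=> // [t tl'|r]; first by apply: cy; lra.
apply: Cr_on_sub (Cy r) => t /=; rewrite !in_itv /= => /andP[t0 tl'].
by apply/andP; split; lra.
Qed.

Lemma near0_lt (P : R -> Prop) : (\forall t \near 0, P t) ->
  exists2 e : R, 0 < e & forall t, `|t| < e -> P t.
Proof.
move=> /nbhs_ballP[e /= e0 eP]; exists e => // t te.
by apply: eP; rewrite /ball /= sub0r normrN.
Qed.

Lemma near0_norm_lt (e : R) : 0 < e -> \forall t \near (0 : R), `|t| < e.
Proof.
move=> e0; have /cvgrPdist_lt/(_ _ e0) := @cvg_id _ (nbhs (0 : R)).
by apply: filterS => t; rewrite sub0r normrN.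
Qed.

(* [D_a f] vanishes at the origin, so the implicit function theorem does not apply
   there; but [f] is strictly convex in the direction [a], and a strictly convex
   function that is nonpositive at [0], negative somewhere and positive at [d] has a
   unique zero in []0, d[], at which its derivative is positive. *)
Lemma implicit_branch f a b c y (l : R) :
    smooth f -> 0 < l -> right_branch l y ->
    f 0 = 0 -> 'D_a f 0 = 0 -> 0 < 'D_a ('D_a f) 0 ->
    (forall t, 0 < t < l -> f (y t *: b + t *: c) <= 0) ->
    (forall d, 0 < d -> exists2 e, 0 < e & forall t, 0 < t < e ->
       exists2 p, 0 <= p < d & f (p *: a + (y t *: b + t *: c)) < 0) ->
  exists z, exists l', exists d, [/\ 0 < l' <= l, 0 < d, right_branch l' z,
      forall t, 0 < t < l' -> 0 < z t /\ f (curve a b c z y t) = 0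
    & forall t p, 0 < t < l' -> 0 <= p < d ->
        f (p *: a + (y t *: b + t *: c)) < 0 -> p <= z t].
Proof.
move=> Sf l0 [cy y0 Cy] f0 Daf0 Daaf0 fle0 fneg.
have Saf : smooth ('D_a f) := smooth_derive a Sf.
have Saaf : smooth ('D_a ('D_a f)) := smooth_derive a Saf.
pose u t := y t *: b + t *: c.
have u0 : u 0 = 0 by rewrite /u y0// !scale0r addr0.
have cu t : t < l -> {for t, continuous u}.
  move=> tl; apply: cvgD; first by apply: cvgZr_tmp; exact: cy.
  by apply: cvgZr_tmp; exact: cvg_id.
have cfu (w t : R) : t < l -> {for t, continuous (fun s => f (w *: a + u s))}.
  move=> tl; apply: continuous_comp; last exact: smooth_continuous.
  by apply: cvgD; [exact: cvg_cst|exact: cu].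
(* Strict convexity in direction [a] on a fixed interval of length [d], uniformly in the base point
   [u t] for small [t]. *)
have [d d0 ndu] : exists2 d : R, 0 < d & \forall v \near u 0, forall s,
    `|s - 0| <= d -> 0 < 'D_a ('D_a f) (s *: a + v).
  apply: (@nbhs_line _ _ [set v | 0 < 'D_a ('D_a f) v] a 0 (u 0)).
  rewrite u0 scale0r addr0.
  exact: (@near_gt0 _ ('D_a ('D_a f)) 0 (smooth_continuous Saaf (x := 0)) Daaf0).
have dline v (x : R) : is_derive x 1 (fun s => f (s *: a + v)) ('D_a f (x *: a + v)).
  exact: is_derive_line.
have dline2 v (x : R) : is_derive x 1 (fun s => 'D_a f (s *: a + v))
    ('D_a ('D_a f) (x *: a + v)) by exact: is_derive_line.
have fpos w : 0 < w <= d -> 0 < f (w *: a + u 0).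
  apply: (convex_pos (dline (u 0)) (dline2 (u 0))).
  - by move=> x /andP[x0 xd]; apply: (nbhs_singleton ndu); rewrite subr0 ger0_norm.
  - by rewrite u0 addr0 scale0r.
  - by rewrite u0 addr0 scale0r.
have fpos_near w : 0 < w <= d -> \forall t \near 0, 0 < f (w *: a + u t).
  by move=> /fpos; exact: near_gt0 (cfu w 0 l0).
have [e1 e10 e1P] : exists2 e : R, 0 < e & forall t, `|t| < e ->
    (forall s, `|s - 0| <= d -> 0 < 'D_a ('D_a f) (s *: a + u t)) /\
    0 < f (d *: a + u t).
  apply: near0_lt; have ndu' : \forall t \near 0, forall s,
    `|s - 0| <= d -> 0 < 'D_a ('D_a f) (s *: a + u t) := cu 0 l0 _ ndu.
  have ndf : \forall t \near 0, 0 < f (d *: a + u t).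
    by apply: fpos_near; rewrite d0 lexx.
  by near=> t; split; near: t.
have [e2 e20 e2P] := fneg d d0.
pose l' := Num.min l (Num.min e1 e2).
have l'0 : 0 < l' by rewrite !lt_min l0 e10.
have l'P t : t < l' -> [/\ t < l, t < e1 & t < e2].
  by rewrite !lt_min => /and3P[].
(* The zero provided by convexity for [0 < t < l'], and [0] for [t <= 0]; for [t >= l'] the value is
   the default [0]. *)
have /choice[z zP] : forall t, exists s : R, (0 < t < l' ->
     [/\ 0 < s < d, f (s *: a + u t) = 0, 0 < 'D_a f (s *: a + u t),
         (forall w, 0 < w < s -> f (w *: a + u t) < 0) &
         (forall w, s < w <= d -> 0 < f (w *: a + u t))])
     /\ (t <= 0 -> s = 0).
  move=> t; have [t0|t0] := leP t 0; first by exists 0; split => // /andP[]; lra.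
  have [tl'|tl'] := ltP t l'; last by exists 0; split => // /andP[]; lra.
  have [tl te1 te2] := l'P t tl'.
  have [|Dpos fd] := e1P t; first by rewrite gtr0_norm.
  have [|p p0d fp] := e2P t; first by rewrite t0.
  have [||s [sd fs Ds sl sr]] := convex_zero (dline (u t)) (dline2 (u t)) _ _ p0d fp fd.
  - move=> x /andP[x0 xd]; apply: Dpos; by rewrite subr0 ger0_norm.
  - by rewrite scale0r add0r; apply: fle0; rewrite t0.
  by exists s; split => //; lra.
have zneg t w : 0 < t < l' -> 0 <= w < d -> f (w *: a + u t) < 0 -> w <= z t.
  move=> tl' /andP[w0 wd] fw; have [/(_ tl')[_ _ _ _ sr] _] := zP t.
  rewrite leNgt; apply/negP => zw; have := sr w.
  by rewrite zw (ltW wd) => /(_ isT); lra.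
have zneg' t w : 0 < t < l' -> 0 <= w < d -> f (w *: a + u t) < 0 -> w < z t.
  move=> tl' wd fw; rewrite lt_neqAle zneg// andbT; apply: contraTN fw => /eqP ->.
  by have [/(_ tl')[_ -> _ _ _] _] := zP t; rewrite ltxx.
have zpos t w : 0 < t < l' -> 0 < w < d -> 0 < f (w *: a + u t) -> z t < w.
  move=> tl' /andP[w0 wd] fw; have [/(_ tl')[_ fz _ sl _] _] := zP t.
  rewrite ltNge; apply/negP; rewrite le_eqVlt => /orP[/eqP E|wz].
    by move: fw; rewrite E fz ltxx.
  by have := sl w; rewrite w0 wz => /(_ isT); lra.
(* For [t > 0] the signs of [f] at two bracketing points persist nearby and trap [z]. At [t = 0]
   positivity of [f] at an arbitrarily small [w > 0] persists and forces [z s < w]. *)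
have cz t : t < l' -> {for t, continuous z}.
  move=> tl'; have [tl _ _] := l'P t tl'; apply/cvgrPdist_lt => /= e e0.
  have [t0|t0|t0] := ltgtP t 0.
  - have [_ ->] := zP t; last exact: ltW.
    near=> s; have [_ ->] := zP s; first by rewrite subrr normr0.
    by apply: ltW; near: s; exact: lt_nbhsl.
  - have tl2 : 0 < t < l' by rewrite t0.
    have [/(_ tl2)[/andP[zt0 ztd] fz _ sl sr] _] := zP t.
    have [|w1 [w2 [w1d w1z w2z w2d zw]]] := @sandwich R (z t) d e _ e0; first by rewrite zt0.
    have w1d' : 0 <= w1 < d by case/andP: w1d => /ltW -> ->.
    have n1 : \forall s \near t, f (w1 *: a + u s) < 0.
      by apply: near_lt0 (cfu w1 t tl) _; apply: sl; case/andP: w1d => -> _.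
    have n2 : \forall s \near t, 0 < f (w2 *: a + u s).
      by apply: near_gt0 (cfu w2 t tl) _; apply: sr; case/andP: w2d => _ /ltW ->; rewrite w2z.
    near=> s.
    have sl' : 0 < s < l'.
      by apply/andP; split; near: s; [exact: lt_nbhsr|exact: lt_nbhsl].
    have : w1 < z s.
      by apply: zneg' => //; near: s.
    have : z s < w2.
      by apply: zpos => //; near: s.
    by move=> ? ?; exact: zw.
  - rewrite {}t0 in tl' tl *; have [_ ->//] := zP 0.
    pose w := Num.min (d / 2) e.
    have we : w <= e by rewrite ge_min lexx orbT.
    have w0 : 0 < w by rewrite lt_min e0 divr_gt0.
    have wd : w < d by rewrite gt_min gtr_pMr// invf_lt1// ltr1n.
    have n2 : \forall s \near 0, 0 < f (w *: a + u s).
      by apply: fpos_near; rewrite w0 ltW.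
    near=> s; have [s0|s0] := leP s 0.
      by have [_ ->//] := zP s; rewrite subrr normr0.
    have sl' : 0 < s < l'.
      by apply/andP; split => //; near: s; exact: lt_nbhsl.
    have [/(_ sl')[/andP[zs0 _] _ _ _ _] _] := zP s.
    rewrite sub0r normrN gtr0_norm// (lt_le_trans _ we)//.
    by apply: zpos => //; [rewrite w0|near: s].
have curveE t : curve a b c z y t = z t *: a + u t by rewrite /curve addrA.
exists z, l', d; split => //.
- by rewrite l'0 /l' ge_min lexx.
- split => // [t t0|r]; first by have [_ ->] := zP t.
  have zeq : forall t, 0 < t < l' -> f (curve a b c z y t) = 0.
    by move=> t tl'; rewrite curveE; have [/(_ tl')[]] := zP t.
  have Dane0 t : `]0, l'[%classic t -> ('D_a f \o curve a b c z y) t != 0.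
    rewrite /= in_itv /= => tl'; rewrite curveE.
    by have [/(_ tl')[_ _ /lt0r_neq0]] := zP t.
  (* Bootstrapping: the formula for [z'] involves only [z], [y] and [y'], so [z] being [r] times
     differentiable makes [z'] so as well. *)
  elim: r => // r IHr.
  have {}Cy r' : Cr_on r' `]0, l'[%classic y.
    apply: Cr_on_sub (Cy r') => t /=; rewrite !in_itv /= => /andP[-> /l'P[]//].
  have [y' yy' Cy'] := Cy r.+1.
  exists (- (y' * ('D_b f \o curve a b c z y) + ('D_c f \o curve a b c z y))
          * (fun t => (('D_a f \o curve a b c z y) t)^-1)).
    move=> t tl'; apply: implicit_derive => //; last exact: Dane0.
    - by apply: cz; move: tl'; rewrite /= in_itv /= => /andP[].
    - exact: yy'.
    - have oI : open `]0, l'[%classic by exact: interval_open.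
      have := open_nbhs_nbhs (conj oI tl').
      by apply: filterS => s /=; rewrite in_itv /=; exact: zeq.
  have Cal g : smooth g -> Cr_on r `]0, l'[%classic (g \o curve a b c z y).
    by move=> Sg; exact: Cr_on_along.
  apply: Cr_onM; last by apply: Cr_onV => //; exact: Cal.
  apply/Cr_onN/Cr_onD; last by apply: Cal; exact: smooth_derive.
  by apply: Cr_onM => //; apply: Cal; exact: smooth_derive.
- move=> t tl'; rewrite curveE.
  by have [/(_ tl')[/andP[? _] ? _ _ _] _] := zP t.
Unshelve. all: by end_near. Qed.

End ImplicitBranch.

(** * Solving the equilibrium equation layer by layer *)

Section BranchChain.
Variables (R : realType) (n : nat).
Variables (f : 'rV[R]_n.+1 -> R) (a b c : 'rV[R]_n.+1).
(* The signs say that the leading part [z^2 Daa/2 + y Db + z t Dca] of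
   [f (z a + y b + t c)] is convex in [z], negative at [z = 0] if [y > 0], and negative
   at [z = mu t] if [y = 0]: this is what forces a positive zero [z]. *)
Hypotheses (Sf : smooth f) (fc : forall t, f (t *: c) = 0).
Hypotheses (Da : 'D_a f 0 = 0) (Daa : 0 < 'D_a ('D_a f) 0).
Hypotheses (Db : 'D_b f 0 < 0) (Dca : 'D_c ('D_a f) 0 < 0).

Let f0 : f 0 = 0. Proof. by rewrite -(fc 0) scale0r. Qed.

Let cvg_scale (v : 'rV[R]_n.+1) : {for 0, continuous (fun t : R => t *: v)}.
Proof. by apply: cvgZr_tmp; exact: cvg_id. Qed.

Lemma decr_right (g : R -> R) (d : R) : is_derive (0 : R) 1 g d -> g 0 = 0 -> d < 0 ->
  exists2 e, 0 < e & forall t, 0 < t < e -> g t < 0.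
Proof.
move=> /is_derive_cvg dg g0 d0.
have : \forall h \near 0^', h^-1 * (g (0 + h) - g 0) < 0.
  by apply: (dg [set r | r < 0]); apply: open_nbhs_nbhs; split; [exact: open_lt|].
move=> /near0_lt[e e0 eP]; exists e => // t /andP[t0 te].
have := eP t; rewrite gtr0_norm// => /(_ te (lt0r_neq0 t0)).
by rewrite add0r g0 subr0 pmulr_rlt0// invr_gt0.
Qed.

Lemma nbhs_ray (W : set 'rV[R]_n.+1) v w : nbhs (0 : 'rV[R]_n.+1) W ->
  exists2 e, 0 < e & forall s t, `|s| < e -> `|t| < e -> W (s *: v + t *: w).
Proof.
move=> nW; have [|d d0 nd] := @nbhs_line R n W v 0 (0 *: w).
  by rewrite !scale0r addr0.
have /near0_lt[e e0 eP] : \forall t \near 0, forall s, `|s - 0| <= d -> W (s *: v + t *: w).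
  exact: (@cvg_scale w _ nd).
exists (Num.min d e); first by rewrite lt_min d0.
move=> s t; rewrite !lt_min => /andP[sd _] /andP[_ te].
by apply: eP => //; rewrite subr0 ltW.
Qed.

(** The leading part [z^2 Daa / 2 + z t Dca] has its minimum at [z = - Dca / Daa * t]. Half of that
    slope is taken, so that the derivative in [z] at [mu * t] is still negative, namely
    [Dca / 2 * t] to first order. *)
Let mu := - 'D_c ('D_a f) 0 / ('D_a ('D_a f) 0) / 2.

Let mu0 : 0 < mu.
Proof. by rewrite /mu !divr_gt0// oppr_gt0. Qed.

(** At [s = mu * t] the derivative [D_a f] is negative, and it increases with [s] by [Daa > 0].
    Hence it is negative on the whole segment from [s = 0], where [f] vanishes. *)
Lemma neg_along_ray : exists2 e, 0 < e &
  forall t, 0 < t < e -> f ((mu * t) *: a + t *: c) < 0.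
Proof.
have Saf : smooth ('D_a f) := smooth_derive a Sf.
have Saaf : smooth ('D_a ('D_a f)) := smooth_derive a Saf.
have nW := near_gt0 (smooth_continuous Saaf (x := 0)) Daa.
have [e1 e10 e1P] := nbhs_ray a c nW.
have [e2 e20 e2P] : exists2 e, 0 < e &
    forall t, 0 < t < e -> 'D_a f ((mu * t) *: a + t *: c) < 0.
  have dmu : is_derive (0 : R) 1 ( *%R mu) mu.
    by rewrite -[X in is_derive _ _ _ X]mulr1; exact: is_deriveZ.
  have Sf0 := smooth_differentiable (curve a b c ( *%R mu) (cst 0) 0) Saf.
  have c0 : curve a b c ( *%R mu) (cst 0) 0 = 0 by rewrite /curve mulr0 !scale0r !addr0.
  have := is_derive_along Sf0 dmu (is_derive_cst (0 : R) (0 : R) (1 : R)).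
  rewrite c0 mul0r addr0 => /decr_right[||e e0 eP].
  - by rewrite /= c0.
  - by rewrite half_ratio ?gt_eqF// pmulr_llt0// invr_gt0.
  exists e => // t /eP; by rewrite /= /curve scale0r addr0.
exists (Num.min (Num.min e1 e2) (e1 / mu)); first by rewrite !lt_min e10 e20 divr_gt0.
move=> t /andP[t0]; rewrite !lt_min ltr_pdivlMr// => /andP[/andP[te1 te2] tmu].
have mut : 0 < mu * t by rewrite mulr_gt0.
have dg (x : R) : is_derive x 1 (fun s => f (s *: a + t *: c)) ('D_a f (x *: a + t *: c)).
  exact: is_derive_line.
have ddg (x : R) : is_derive x 1 (fun s => 'D_a f (s *: a + t *: c))
    ('D_a ('D_a f) (x *: a + t *: c)) by exact: is_derive_line.
have [s /andP[s0 st]] := mvt_lt mut dg; rewrite scale0r add0r fc !subr0 => ->.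
rewrite pmulr_llt0//; have [r /andP[sr rt] E] := mvt_lt st ddg.
have : 0 < 'D_a ('D_a f) (r *: a + t *: c).
  by apply: e1P; rewrite gtr0_norm//; [apply: lt_trans rt _; rewrite mulrC|exact: lt_trans sr].
rewrite -(pmulr_lgt0 _ (_ : 0 < mu * t - s)) ?subr_gt0// -E subr_gt0 => /lt_trans; apply.
by apply: e2P; rewrite t0.
Qed.

(** Here the sources are at [0], and the negative value required by [implicit_branch] is found at
    [mu * t]. The bound [mu * t <= z t] records the linear growth that later separates the branch
    from the trivial one. *)
Lemma first_branch : exists z l, [/\ 0 < l, right_branch l z,
  forall t, 0 < t < l -> mu * t <= z t
  & forall t, 0 < t < l -> 0 < z t /\ f (curve a b c z (cst 0) t) = 0].
Proof.
have [e e0 eP] := neg_along_ray.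
have y0 : right_branch 1 (cst 0 : R -> R).
  by split=> // [t _|r]; [exact: cst_continuous|exact: Cr_on_cst].
have [t _|d d0|z [l' [d [/andP[l'0 _] d0 bz z0 zlow]]]] :=
   @implicit_branch R n f a b c (cst 0) 1 Sf ltr01 y0 f0 Da Daa.
- by rewrite scale0r add0r fc.
- exists (Num.min e (d / mu)); first by rewrite lt_min e0 divr_gt0.
  move=> t /andP[t0]; rewrite lt_min ltr_pdivlMr// => /andP[te td].
  exists (mu * t); first by rewrite mulr_ge0 ?ltW//= mulrC.
  by rewrite scale0r add0r; apply: eP; rewrite t0.
(* The bound [d / mu] keeps [mu * t] below [d], as the lower bound on [z] requires. *)
exists z, (Num.min l' (Num.min e (d / mu))).
have l''l' : Num.min l' (Num.min e (d / mu)) <= l' by rewrite ge_min lexx.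
split; first by rewrite !lt_min l'0 e0 divr_gt0.
- exact: right_branchW bz.
- move=> t /andP[t0]; rewrite !lt_min ltr_pdivlMr// => /and3P[tl te td].
  apply: zlow; first by rewrite t0.
  + by rewrite mulr_ge0 ?ltW//= mulrC.
  by rewrite scale0r add0r; apply: eP; rewrite t0.
- move=> t /andP[t0 tl]; apply: z0; rewrite t0; exact: lt_le_trans l''l'.
Qed.

(** Since [D_b f < 0] near the origin, a positive state [y] of the sources already makes [f]
    negative at [z = 0]. *)
Lemma next_branch y l : 0 < l -> right_branch l y -> (forall t, 0 < t < l -> 0 < y t) ->
  exists z l', [/\ 0 < l' <= l, right_branch l' z
    & forall t, 0 < t < l' -> 0 < z t /\ f (curve a b c z y t) = 0].
Proof.
move=> l0 by_ ypos; have [cy y0 Cy] := by_.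
have Sbf : smooth ('D_b f) := smooth_derive b Sf.
have [e1 e10 e1P] := nbhs_ray b c (near_lt0 (smooth_continuous Sbf (x := 0)) Db).
have [e2 e20 e2P] : exists2 e, 0 < e & forall t, `|t| < e -> `|y t| < e1.
  apply: near0_lt; have /cvgrPdist_lt/(_ _ e10) := cy 0 l0.
  by rewrite y0//; apply: filterS => t; rewrite sub0r normrN.
pose l1 := Num.min l (Num.min e1 e2).
have l10 : 0 < l1 by rewrite !lt_min l0 e10.
have fyneg t : 0 < t < l1 -> f (y t *: b + t *: c) < 0.
  move=> /andP[t0]; rewrite !lt_min => /and3P[tl te1 te2].
  have yt0 : 0 < y t by apply: ypos; rewrite t0.
  have [s /andP[s0 s1]] := mvt_line b (t *: c) (y t) Sf.
  rewrite fc subr0 => ->; rewrite pmulr_rlt0//; apply: e1P; last by rewrite gtr0_norm.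
  have := e2P t; rewrite !gtr0_norm// ?mulr_gt0// => /(_ te2); apply: le_lt_trans.
  by rewrite ler_piMl// ltW.
have l1l : l1 <= l by rewrite ge_min lexx.
have [t /fyneg /ltW //|d d0|z [l' [d [/andP[l'0 l'l1] _ bz z0 _]]]] :=
   @implicit_branch R n f a b c y l1 Sf l10 (right_branchW l1l by_) f0 Da Daa.
- exists l1 => // t tl1; exists 0; first by rewrite lexx.
  by rewrite scale0r add0r; exact: fyneg.
exists z, l'; split => //; first by rewrite l'0 (le_trans l'l1).
Qed.

Lemma branch_chain m : exists (Y : nat -> R -> R) (l mu : R), [/\ 0 < l, 0 < mu,
    Y 0 = cst 0, forall j, right_branch l (Y j)
  & forall t, 0 < t < l -> [/\ mu * t <= Y 1 t,
      forall j, (0 < j)%N -> 0 < Y j t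
      & forall j, (j <= m)%N -> f (curve a b c (Y j.+1) (Y j) t) = 0]].
Proof.
elim: m => [|m [Y [l [nu [l0 nu0 Y0 bY YP]]]]].
  have [z [l [l0 bz zmu z0]]] := first_branch.
  exists (fun j => if j is 0 then cst 0 else z), l, mu; split=> // [[|j] //|t tl].
    by split=> // [t _|r]; [exact: cst_continuous|exact: Cr_on_cst].
  by split => [|[|j] _|[|j] _] //; have [? ?] := z0 t tl => //; exact: zmu.
have [|z [l' [/andP[l'0 l'l] bz z0]]] := @next_branch (Y m.+1) l l0 (bY m.+1).
  by move=> t /YP[_ /(_ m.+1) + _]; exact.
(* All indices beyond [m.+1] receive the new solution, so that positivity holds for every
   [j > 0]. *)
exists (fun j => if (j <= m.+1)%N then Y j else z), l', nu.
split=> // [j|t tl'].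
  by case: ifP => _ //; exact: right_branchW (bY j).
have [|mut Yt ft] := YP t.
  by case/andP: tl' => -> /lt_le_trans; apply.
split=> // j; first by case: ifP => // _ /Yt //; have [] := z0 t tl'.
have [jm|//|->] := ltngtP j m.+1 => _; first exact: ft.
by have [] := z0 t tl'.
Qed.

End BranchChain.

(** * Lifts of feed-forward networks *)

Section Lifts.
Local Open Scope quotient_scope.
Local Open Scope nat_scope.

(** Composing the projection with the inverse of the isomorphism replaces the quotient by a
    surjective network map whose fibers are the classes of the coloring. *)
Lemma lift_map k (L N : network k) (e : equiv_rel L) :
  balanced e -> network_eq N (quotient_network e) ->
  exists phi : L -> N, [/\ forall i c, phi (src i c) = src i (phi c),
    forall c d, e c d -> phi c = phi d, forall c d, phi c = phi d -> e c d
    & forall x, exists c, phi c = x].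
Proof.
move=> be [psi [[psi' psiK psi'K] psi_src]].
have psi'_src i x : psi' (src i x) = src i (psi' x).
  by apply: (can_inj psiK); rewrite psi'K psi_src psi'K.
exists (fun c => psi' (\pi_({eq_quot e}) c)); split.
- by move=> i c; rewrite -psi'_src src_quotient.
- by move=> c d ecd; congr psi'; exact/eqmodP.
- by move=> c d /(can_inj psi'K) /eqmodP.
- by move=> x; exists (repr (psi x : quot_type {eq_quot e})); rewrite reprK psiK.
Qed.

Variable k : nat.

Section FeedForward.
Variables (N : network k) (m : nat) (ell : N -> nat).
Hypothesis hN : feed_forward m ell.

Lemma ff_le c : ell c <= m. Proof. by case: hN => -[]. Qed.

Lemma ff_src0 i c : ell c = 0 -> src i c = c.
Proof. by case: hN => _ H _ _ _ c0; apply: H; rewrite inE c0. Qed.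

Lemma ff_srcS i c j : ell c = j.+1 -> ell (src i c) = j.
Proof.
case: hN => _ _ H _ _ cj; apply/eqP; have := H j.+1 i c.
by rewrite !inE cj eqxx => -> //=; rewrite -cj ff_le.
Qed.

Lemma ff_cover c : ell c < m -> exists i c', ell c' = (ell c).+1 /\ c = src i c'.
Proof.
case: hN => _ _ _ H _ cm; have [|i [c' + ->]] := H (ell c) c cm.
  by rewrite inE.
by rewrite inE => /eqP c'E; exists i, c'; rewrite (ff_srcS i c'E).
Qed.

Lemma ff_layer j : j <= m -> exists c, ell c = j.
Proof.
case: hN => -[_ H] _ _ _ _ /H /set0Pn[c].
by rewrite inE => /eqP; exists c.
Qed.

Lemma ff_edge : 0 < m -> exists i : 'I_k, True.
Proof.
by move=> m0; have [c c0] := ff_layer (leq0n m); have [|i _] := @ff_cover c; [rewrite c0|exists i].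
Qed.

End FeedForward.

Section LiftMap.
Variables (N L : network k) (m n : nat) (ell : N -> nat) (ell' : L -> nat).
Hypotheses (hN : feed_forward m ell) (hL : feed_forward n ell').
Variable phi : L -> N.
Hypothesis phi_src : forall i c, phi (src i c) = src i (phi c).

(* Going up from [c] in [L], the images also go up in [N], so that the top of
   [N] bounds the number of layers of [L] above [c]. *)
Lemma layer_lift c : 0 < ell (phi c) -> ell (phi c) + (n - ell' c) <= m.
Proof.
move sE : (n - ell' c) => s; elim: s c sE => [|s IHs] c cs phic.
  by rewrite addn0 ff_le.
have [|i [c' [c'E cE]]] := ff_cover hL (c := c); first by rewrite -subn_gt0 cs.
have := phic; rewrite cE phi_src; case E : (ell (phi c')) => [|j].
  by rewrite (ff_src0 hN) // E.
rewrite (ff_srcS hN _ E) => _; rewrite addnS -addSn -E; apply: IHs; last by rewrite E.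
by rewrite c'E subnS cs.
Qed.

(** An image outside the first layer would give [1 + (n - 1) <= m]; cells of the first layer are
    their own sources. *)
Lemma layer1_collapse c i : m < n -> ell' c = 1 -> phi (src i c) = phi c.
Proof.
move=> mn c1; rewrite phi_src (ff_src0 hN)//.
case E : (ell (phi c)) => [//|j]; have := @layer_lift c.
by rewrite E c1 => /(_ isT); lia.
Qed.

Hypothesis phi_surj : forall x, exists c, phi c = x.

(** The chain [#|layer ell j| <= #|image| <= #|layer ell' j|] has equal ends, so both inclusion and
    map are tight. *)
Lemma imset_layer j : (forall x, ell x = j -> exists2 c, phi c = x & ell' c = j) ->
  #|layer ell' j| = #|layer ell j| ->
  layer ell j = [set phi c | c in layer ell' j]%SET
  /\ {in layer ell' j &, injective phi}.
Proof.
move=> surj_j cardE.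
have sub : layer ell j \subset [set phi c | c in layer ell' j]%SET.
  apply/fintype.subsetP => x; rewrite inE => /eqP /surj_j[c <- cj].
  by apply: imset_f; rewrite inE cj.
have le := leq_imset_card phi (mem (layer ell' j)).
have E : layer ell j = [set phi c | c in layer ell' j]%SET.
  by apply/eqP; rewrite eqEcard sub -cardE.
by split=> //; apply/imset_injP; rewrite -E cardE.
Qed.

Lemma lift_inside_inj c d : m = n ->
  (forall j, 0 < j <= m -> #|layer ell' j| = #|layer ell j|) ->
  phi c = phi d -> c = d \/ ell' c = 0 /\ ell' d = 0.
Proof.
move=> mn cardE; have [m0|m0] := posnP m.
  by move=> _; right; have := ff_le hL c; have := ff_le hL d; lia.
(* By [layer_lift], every preimage of a top cell of [N] is a top cell of [L]. *)
have [top _] : layer ell m = [set phi c | c in layer ell' m]%SET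
    /\ {in layer ell' m &, injective phi}.
  apply: imset_layer; last by apply: cardE; rewrite m0 leqnn.
  move=> x xm; have [b bx] := phi_surj x; exists b => //.
  have := @layer_lift b; rewrite bx xm => /(_ m0); have := ff_le hL b; lia.
(* Downward induction from the top layer: [b] is a source of some cell one layer higher, whose image
   is in the right layer. *)
have ellE b : ell (phi b) = ell' b.
  move sE : (m - ell' b) => s; elim: s b sE => [|s IHs] b bs.
    have bm : ell' b = m by have := ff_le hL b; lia.
    have : phi b \in layer ell m by rewrite top imset_f// inE bm.
    by rewrite inE bm => /eqP.
  have [|i [b' [b'E bE]]] := ff_cover hL (c := b); first by rewrite -mn; lia.
  have b'm : ell (phi b') = (ell' b).+1 by rewrite IHs// b'E; lia.
  by rewrite {1}bE phi_src (ff_srcS hN _ b'm).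
move=> cd; have cdE : ell' c = ell' d by rewrite -!ellE cd.
have [d0|d0] := posnP (ell' d); [by right; rewrite cdE d0|left].
have [||_] := @imset_layer (ell' d).
- by move=> x xd; have [b bx] := phi_surj x; exists b => //; rewrite -ellE bx.
- by apply: cardE; rewrite d0 mn ff_le.
by apply; rewrite ?inE ?cdE.
Qed.

End LiftMap.

Lemma connected_no_edge (N : network k) (c d : N) :
  k = 0 -> connected_network N -> c = d.
Proof.
move=> k0 /(_ c d) /connectP[[|x p] /=]; first by move=> _ ->.
by move=> /andP[/existsP[i _]]; have := ltn_ord i; rewrite [X in _ < X]k0.
Qed.

End Lifts.

(** * Germs of equilibrium branches *)

Section Branches.
Variables (R : realType) (k : nat) (L : network k) (f : 'rV[R]_k.+2 -> R).
Implicit Types b : branch R L.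

Lemma equilibrium_dom0 b : equilibrium_branch f b -> bdom b 0.
Proof.
move=> [[[[l l0 ->] _]|[[l l0 [->|->]] _]] _ _]; rewrite /= in_itv /=.
- by rewrite oppr_lt0 l0.
- by rewrite oppr_lt0 l0 lexx.
- by rewrite l0 lexx.
Qed.

Lemma equilibrium_small b c (e : R) : equilibrium_branch f b -> 0 < e ->
  \forall lam \near 0, bdom b lam -> `|b lam c| < e.
Proof.
move=> eb e0; have D0 := equilibrium_dom0 eb.
have [[[_ sm]|[_ cont]] b0 _] := eb.
  have := sm c 0 0 D0; rewrite derive1n0 => /derivable1_diffP/differentiable_continuous.
  move=> /cvgrPdist_lt/(_ _ e0).
  rewrite /= b0; apply: filterS => lam.
  by rewrite sub0r normrN.
have [/subspace_continuousP/(_ 0 D0) + _] := cont c.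
move=> /cvgrPdist_lt/(_ _ e0); rewrite /from_subspace /= b0 => near_b.
have {}near_b : \forall lam \near 0, bdom b lam -> `|0 - b lam c| < e := near_b.
by apply: filterS near_b => lam H /H; rewrite sub0r normrN.
Qed.

(* The sign condition [0 <= x * lam] says that [lam] is on the side of [x]. *)
Lemma equilibrium_dom_side b (x : R) : equilibrium_branch f b -> bdom b x -> x != 0 ->
  \forall lam \near 0, 0 <= x * lam -> bdom b lam.
Proof.
move=> [dom _ _] Dx x0; have nx : 0 < `|x| by rewrite normr_gt0.
apply: filterS (near0_norm_lt nx) => lam lamx.
have [x1|x1|x1] := ltgtP x 0; last by rewrite x1 eqxx in x0.
  rewrite nmulr_rge0// => lam0; move: lamx; rewrite (ltr0_norm x1) (ler0_norm lam0) ltrN2 => lamx.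
  by case: dom => [[[l l0 E] _]|[[l l0 [E|E]] _]]; move: Dx; rewrite E /= !in_itv /= => /andP[? ?];
     apply/andP; split; lra.
rewrite pmulr_rge0// => lam0; move: lamx; rewrite (gtr0_norm x1) (ger0_norm lam0) => lamx.
by case: dom => [[[l l0 E] _]|[[l l0 [E|E]] _]]; move: Dx; rewrite E /= !in_itv /= => /andP[? ?];
   apply/andP; split; lra.
Qed.

Lemma one_sided_side (D : set R) (x lam : R) :
  one_sided D -> D x -> D lam -> 0 <= x * lam.
Proof.
move=> [l l0 [->|->]]; rewrite /= !in_itv /= => /andP[? ?] /andP[? ?].
  exact: mulr_le0.
exact: mulr_ge0.
Qed.

(* A two-sided branch is differentiable at [0], so a linear lower bound on one side
   carries over to the other: [linear_growth] is invariant under germ equivalence,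
   whereas being nonzero on one side need not be. *)
Definition linear_growth (c : L) b : Prop :=
  exists2 nu : R, 0 < nu &
    \forall lam \near 0, bdom b lam -> nu * `|lam| <= `|b lam c|.

(** The bound passes to [b2] on a side of [0] common to both domains. If [b2] is two-sided, its
    derivative at [0] then has absolute value at least [nu], which gives the bound [nu / 2] on both
    sides. *)
Lemma related_linear_growth c b1 b2 :
  related f b1 b2 -> linear_growth c b1 -> linear_growth c b2.
Proof.
move=> [eb1 eb2 [U [oU neq eqU]]] [nu nu0 n1].
(* The intersection contains [0], so differing from [{0}] provides a nonzero point; its sign selects
   the common side. *)
have [x [Ux Dx1 Dx2 x0]] : exists x, [/\ U x, bdom b1 x, bdom b2 x & x != 0].
  apply: contrapT => H; apply: neq; apply/seteqP; split => [x [[Ux D1] D2]|x ->] /=.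
    by apply: contrapT => /eqP x0; apply: H; exists x.
  by split; [split|]; [case: oU|exact: equilibrium_dom0 eb1|exact: equilibrium_dom0 eb2].
have nD1 := equilibrium_dom_side eb1 Dx1 x0.
have nD2 := equilibrium_dom_side eb2 Dx2 x0.
have nU := open_nbhs_nbhs oU.
have side : \forall lam \near 0, 0 <= x * lam -> nu * `|lam| <= `|b2 lam c|.
  near=> lam => xlam.
  have D1 : bdom b1 lam by move: xlam; near: lam.
  have D2 : bdom b2 lam by move: xlam; near: lam.
  rewrite -(eqU lam); last by split => //; split => //; near: lam.
  by move: D1; near: lam.
have [[[_ sm]|[os _]] b20 _] := eb2; last first.
  by exists nu => //; apply: filterS side => lam H D2; apply/H/(one_sided_side os Dx2).
have [d cd] : exists d : R, h^-1 * (b2 (0 + h) c - b2 0 c) @[h --> 0^'] --> d.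
  have /(_ (equilibrium_dom0 eb2)) := sm c 0 0.
  by rewrite derive1n0 => /derivableP/is_derive_cvg; exists ('D_1 (b2 ^~ c) 0).
have cnd : `|h^-1 * (b2 (0 + h) c - b2 0 c)| @[h --> 0^'] --> `|d| by exact: cvg_norm.
have nud : nu <= `|d|.
  rewrite leNgt; apply/negP => dnu.
  have : \forall h \near 0^', `|h^-1 * (b2 (0 + h) c - b2 0 c)| < nu.
    by apply: (cnd [set r | r < nu]); apply: open_nbhs_nbhs; split; [exact: open_lt|].
  move=> /near0_lt[e1 e10 e1P]; have [e2 e20 e2P] := near0_lt side.
  have nx : 0 < `|x| by rewrite normr_gt0.
  (* The test point [e * x] lies on the side of [x] and within both radii. *)
  pose e := Num.min e1 e2 / (2 * `|x|).
  have e0 : 0 < e by rewrite divr_gt0 ?mulr_gt0// lt_min e10.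
  have : `|e * x| < Num.min e1 e2.
    rewrite normrM gtr0_norm// /e invfM mulrA mulfVK ?gt_eqF//.
    by rewrite gtr_pMr ?lt_min ?e10// invf_lt1// ltr1n.
  rewrite lt_min => /andP[xe1 xe2].
  have ex0 : e * x != 0 by rewrite mulf_neq0// gt_eqF.
  have := e1P _ xe1 ex0; rewrite add0r b20 subr0 normrM normfV.
  rewrite ltr_pdivrMl ?normr_gt0// [_ * nu]mulrC ltNge e2P//.
  by rewrite mulrCA mulr_ge0 ?ltW// -expr2 exprn_even_gt0.
exists (nu / 2); first by rewrite divr_gt0.
have : \forall h \near 0^', nu / 2 < `|h^-1 * (b2 (0 + h) c - b2 0 c)|.
  apply: (cnd [set r | nu / 2 < r]); apply: open_nbhs_nbhs; split; first exact: open_gt.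
  by apply: lt_le_trans nud; rewrite ltr_pdivrMr// ltr_pMr// ltr1n.
move=> /near0_lt[e e0 eP].
apply: filterS (near0_norm_lt e0) => h he _; have [->|h0] := eqVneq h 0.
  by rewrite normr0 mulr0.
have := eP h he h0; rewrite add0r b20 subr0 normrM normfV => /ltW.
by rewrite ler_pdivlMl ?normr_gt0// mulrC.
Unshelve. all: by end_near. Qed.

Lemma linear_growth_nontrivial c b : linear_growth c b -> ~ germ_equiv f b (trivial_branch R L).
Proof.
move=> gb; have germ b1 b2 : germ_equiv f b1 b2 -> linear_growth c b1 -> linear_growth c b2.
  by elim=> [x y|x y z _ IH1 _ IH2 /IH1]; [exact: related_linear_growth|].
move=> /germ/(_ gb)[nu nu0 /near0_lt[e e0 eP]].
(* A positive point within the radius [e] and the domain []-1, 1[] of the trivial branch. *)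
pose h := Num.min (e / 2) (1 / 2).
have he : h <= e / 2 by rewrite ge_min lexx.
have h1 : h <= 1 / 2 by rewrite ge_min lexx orbT.
have h0 : 0 < h by rewrite lt_min !divr_gt0.
have := eP h; rewrite /= in_itv /= gtr0_norm// normr0 leNgt mulr_gt0//.
have he' : h < e by lra.
have h1' : -1 < h < 1 by apply/andP; split; lra.
by move=> /(_ he' h1').
Qed.

(** The mean value theorem writes [f (x *: v + t *: w)] as [x] times a value of [D_v f] near the
    origin, which is nonzero. *)
Lemma vanishing_of_derive (v w : 'rV[R]_k.+2) : smooth f -> (forall t : R, f (t *: w) = 0) ->
  'D_v f 0 != 0 -> exists2 e : R, 0 < e &
    forall x t, `|x| < e -> `|t| < e -> f (x *: v + t *: w) = 0 -> x = 0.
Proof.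
move=> Sf fw Dv; have Svf : smooth ('D_v f) := smooth_derive v Sf.
have nW := near_neq0 (smooth_continuous Svf (x := 0)) Dv.
have [e e0 eP] := nbhs_ray v w nW; exists e => // x t xe te fxt.
have [s /andP[s0 s1]] := mvt_line v (t *: w) x Sf.
rewrite fxt fw subr0 => /esym/eqP; rewrite mulf_eq0 => /orP[/eqP//|].
have /eP : `|s * x| < e by rewrite normrM gtr0_norm// (le_lt_trans _ xe)// ler_piMl// ltW.
by move=> /(_ _ te) /= /negbTE ->.
Qed.

End Branches.

(** * Genericity *)

Section Generic.
Variables (R : realType) (k : nat).
Implicit Types (f : 'rV[R]_k.+2 -> R) (J : 'rV[R]_k.+2 * 'M[R]_k.+2).

(** The direction in which [x_1, ..., x_k] vary together; the derivative along it is
    [f_1 + ... + f_k]. *)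
Definition sources_dir : 'rV[R]_k.+2 := coord_vec 0 (fun=> 1) 0.

Lemma coord_vecE (z y t : R) : coord_vec z (fun _ : 'I_k => y) t =
  z *: delta_mx 0 ord0 + y *: sources_dir + t *: delta_mx 0 ord_max.
Proof.
apply/rowP => j; rewrite !mxE /=.
have [j' ->|->] := unliftP ord0 j; last by rewrite ?unlift_none eqxx /= mulr1 !mulr0 !addr0.
rewrite [lift _ _ == ord0]eq_sym (negbTE (neq_lift _ _)).
have [i ->|->] := unliftP ord_max j'.
  rewrite (_ : lift ord0 _ == ord_max = false); first by rewrite /=; ring.
  by apply/negbTE; rewrite -val_eqE /= /bump /=; have := ltn_ord i; lia.
by rewrite (_ : lift ord0 _ == ord_max) /=; [ring|rewrite -val_eqE].
Qed.

Lemma sources_dir0 : sources_dir 0 ord0 = 0.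
Proof. by rewrite mxE unlift_none. Qed.

Lemma sources_dir_max : sources_dir 0 ord_max = 0.
Proof.
by rewrite mxE; case: unliftP => // j' /esym; have [i ->|-> //] := unliftP ord_max j';
  move/(congr1 val); rewrite /= /bump /=; have := ltn_ord i; lia.
Qed.

(* [sources_dir] vanishes only for [k = 0], where the summand [1] makes the
   condition [sources_sum J != 0] void. *)
Definition sources_sum J : R :=
  (sources_dir == 0)%:R + \sum_j sources_dir 0 j * J.1 0 j.

Definition nondegenerate_jet J :=
  [/\ sources_sum J != 0, J.2 ord0 ord0 != 0 & J.2 ord_max ord0 != 0].

(** A single continuous function whose nonvanishing expresses nondegeneracy, which is therefore an
    open condition. *)
Definition nondeg_poly J : R := sources_sum J * J.2 ord0 ord0 * J.2 ord_max ord0.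

Lemma nondegenerate_jetP J : nondegenerate_jet J <-> nondeg_poly J != 0.
Proof.
rewrite /nondeg_poly !mulf_eq0 !negb_or; split=> [[-> -> ->] //|].
by move=> /andP[/andP[? ?] ?].
Qed.

Lemma nondeg_poly_continuous : continuous nondeg_poly.
Proof.
move=> J; have entry1 j : {for J, continuous (fun J => J.1 0 j : R)}.
  apply: (@continuous_comp _ _ _ fst (fun M : 'rV[R]_k.+2 => M 0 j)); first exact: cvg_fst.
  exact: coord_continuous.
have entry2 i j : {for J, continuous (fun J => J.2 i j : R)}.
  apply: (@continuous_comp _ _ _ snd (fun M : 'M[R]_k.+2 => M i j)); first exact: cvg_snd.
  exact: coord_continuous.
apply: cvgM; last exact: entry2.
apply: cvgM; last exact: entry2.
apply: cvgD; first exact: cvg_cst.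
apply: cvg_big => [|j _]; first exact: add_continuous.
apply: cvgM; [exact: cvg_cst|exact: entry1].
Qed.

Let X (j : 'I_k.+2) : 'rV[R]_k.+2 -> R := fun x => x 0 j.

Let smoothX j : smooth (X j).
Proof.
move=> r; elim: r j => [|r IHr] j; first exact: coord_continuous.
split=> [x|i]; first exact: differentiable_coord.
by rewrite partial_coord; exact: class_C_cst.
Qed.

Lemma partialD f g i : smooth f -> smooth g ->
  partial i (f + g) = partial i f + partial i g.
Proof.
move=> Sf Sg; apply/funext => x; rewrite /partial deriveD//.
all: exact/diff_derivable/smooth_differentiable.
Qed.

Lemma partialM f g i : smooth f -> smooth g ->
  partial i (f * g) = f * partial i g + g * partial i f.
Proof.
move=> Sf Sg; apply/funext => x; rewrite /partial deriveM//.
all: exact/diff_derivable/smooth_differentiable.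
Qed.

Lemma partial_cst i (a : R) : partial i (cst a : 'rV[R]_k.+2 -> R) = cst 0.
Proof. by apply/funext => x; rewrite /partial derive_cst. Qed.

Lemma partial_scale f i (a : R) : smooth f -> partial i (cst a * f) = cst a * partial i f.
Proof.
move=> Sf; rewrite partialM//; last exact: smooth_cst.
by rewrite partial_cst; apply/funext => x; rewrite !fctE mulr0 addr0.
Qed.

Lemma partial_sum (I : Type) (s : seq I) (F : I -> 'rV[R]_k.+2 -> R) i :
  (forall j, smooth (F j)) ->
  partial i (\sum_(j <- s) F j) = \sum_(j <- s) partial i (F j).
Proof.
move=> SF; elim: s => [|j s IHs]; first by rewrite !big_nil; exact: partial_cst.
by rewrite !big_cons partialD ?IHs//; exact: smooth_sum.
Qed.

(* Adding a small multiple of [bump_poly] makes any jet nondegenerate. *)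
Definition bump_poly : 'rV[R]_k.+2 -> R :=
  X ord0 * (X ord0 + X ord_max) + \sum_j cst (sources_dir 0 j) * X j.

Lemma smooth_bump : smooth bump_poly.
Proof.
apply: smoothD; first by apply: smoothM => //; exact: smoothD.
by apply: smooth_sum => j; apply: smoothM => //; exact: smooth_cst.
Qed.

Lemma partial_bump i : partial i bump_poly =
  cst (((i == ord0)%:R + (i == ord_max)%:R) : R) * X ord0
  + cst ((i == ord0)%:R : R) * (X ord0 + X ord_max) + cst (sources_dir 0 i).
Proof.
have SX := smoothX.
rewrite partialD; [|by apply: smoothM => //; exact: smoothD|]; last first.
  by apply: smooth_sum => j; apply: smoothM => //; exact: smooth_cst.
rewrite partialM//; last exact: smoothD.
rewrite partialD// !partial_coord partial_sum; last first.
  by move=> j; apply: smoothM => //; exact: smooth_cst.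
have -> : \sum_j partial i (cst (sources_dir 0 j) * X j) = cst (sources_dir 0 i).
  apply/funext => x; rewrite fct_sumE (bigD1 i)//= big1 => [|j ji].
    by rewrite partial_scale// partial_coord eqxx !fctE mulr1 addr0.
  by rewrite partial_scale// partial_coord eq_sym (negbTE ji) !fctE mulr0.
by apply/funext => x; rewrite !fctE; ring.
Qed.

Lemma bump_jet :
  [/\ (jet2 bump_poly).1 = sources_dir, (jet2 bump_poly).2 ord0 ord0 = 2
    & (jet2 bump_poly).2 ord_max ord0 = 1].
Proof.
have SX := smoothX; have X0 j : X j 0 = 0 by rewrite /X mxE.
have D2 i : partial i (partial ord0 bump_poly) 0 =
    (i == ord0)%:R + (i == ord0)%:R + (i == ord_max)%:R.
  have -> : partial ord0 bump_poly = X ord0 + (X ord0 + X ord_max).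
    by rewrite partial_bump sources_dir0; apply/funext => x; rewrite !fctE eqxx /=; ring.
  rewrite !partialD//; last exact: smoothD.
  by rewrite !partial_coord !fctE addrA.
split.
- by apply/rowP => i; rewrite mxE partial_bump !fctE !X0; ring.
- by rewrite mxE D2 eqxx /= addr0.
- by rewrite mxE D2 eqxx /= add0r add0r.
Qed.

Lemma jet2_perturb f g (t : R) : smooth f -> smooth g -> jet2 (f + cst t * g) =
  ((jet2 f).1 + t *: (jet2 g).1, (jet2 f).2 + t *: (jet2 g).2).
Proof.
move=> Sf Sg; have P (h1 h2 : 'rV[R]_k.+2 -> R) i : smooth h1 -> smooth h2 ->
    partial i (h1 + cst t * h2) = partial i h1 + cst t * partial i h2.
  move=> S1 S2; rewrite partialD ?partial_scale//.
  by apply: smoothM => //; exact: smooth_cst.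
have SP (h : 'rV[R]_k.+2 -> R) i : smooth h -> smooth (partial i h).
  by move=> Sh; exact: smooth_partial.
congr pair; first by apply/rowP => i; rewrite !mxE P.
by apply/matrixP => i j; rewrite !mxE P// P//; exact: SP.
Qed.

Lemma affine_neq0 (u v : R) : (u != 0) || (v != 0) ->
  \forall t \near 0^', u + t * v != 0.
Proof.
have [-> /= v0|u0 _] := eqVneq u 0.
  near=> t; rewrite add0r mulf_neq0//; near: t; exact: nbhs_dnbhs_neq.
have c : {for 0, continuous (fun t : R => u + t * v)}.
  apply: cvgD; first exact: cvg_cst.
  by apply: cvgM; [exact: cvg_id|exact: cvg_cst].
have := near_neq0 c; rewrite mul0r addr0 => /(_ u0); exact: nbhs_dnbhs.
Unshelve. all: by end_near. Qed.

Lemma cvg_affine (V : normedModType R) (u v : V) :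
  u + t *: v @[t --> (0 : R)] --> u.
Proof.
rewrite -[X in _ --> X]addr0 -[X in _ --> _ + X](scale0r v).
by apply: cvgD; [exact: cvg_cst|apply: cvgZr_tmp; exact: cvg_id].
Qed.

Lemma cvg_pair_nbhs (T : Type) (F : set_system T) (U V : topologicalType)
    (g : T -> U) (h : T -> V) (u : U) (v : V) : Filter F ->
  g x @[x --> F] --> u -> h x @[x --> F] --> v -> (g x, h x) @[x --> F] --> (u, v).
Proof. by move=> FF gu hv; apply: (@cvg_pair _ _ _ F (nbhs u) (nbhs v)). Qed.

Lemma perturb_nondegenerate (J Q : 'rV[R]_k.+2 * 'M[R]_k.+2) :
    Q.1 = sources_dir -> Q.2 ord0 ord0 = 2 -> Q.2 ord_max ord0 = 1 ->
  \forall t \near 0^', nondegenerate_jet (J.1 + t *: Q.1, J.2 + t *: Q.2).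
Proof.
move=> Q1 Q00 Qm0; set s2 := \sum_j sources_dir 0 j * sources_dir 0 j.
(* If [sources_dir] is zero, then [sources_sum J = 1]; otherwise [s2] is a sum of squares that are
   not all zero. *)
have H : (sources_sum J != 0) || (s2 != 0).
  have [e0|e0] := eqVneq sources_dir 0.
    by rewrite /sources_sum e0 eqxx big1 ?addr0 ?oner_neq0// => j _; rewrite mxE mul0r.
  apply/orP; right; apply: contraNneq e0 => s0; apply/eqP/rowP => j; rewrite [RHS]mxE.
  have /eqP : sources_dir 0 j * sources_dir 0 j = 0.
    by apply: (psumr_eq0P _ s0) => // i _; rewrite -expr2 sqr_ge0.
  by rewrite mulf_eq0 orbb => /eqP.
have n1 := affine_neq0 H.
have n2 : \forall t \near 0^', J.2 ord0 ord0 + t * 2 != 0.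
  by apply: affine_neq0; rewrite pnatr_eq0 orbT.
have n3 : \forall t \near 0^', J.2 ord_max ord0 + t * 1 != 0.
  by apply: affine_neq0; rewrite oner_neq0 orbT.
near=> t; split.
- rewrite (_ : sources_sum _ = sources_sum J + t * s2); first by near: t.
  rewrite /sources_sum Q1 -addrA; congr (_ + _).
  rewrite mulr_sumr -big_split; apply: eq_bigr => j _ /=.
  by rewrite !mxE mulrDr [_ * (t * _)]mulrCA.
- rewrite /= !mxE Q00; near: t; exact: n2.
- rewrite /= !mxE Qm0; near: t; exact: n3.
Unshelve. all: by end_near. Qed.

(** For density, [bump_poly] has zero [x_0]-derivative at the origin and vanishes on the parameter
    axis, so [f + t * bump_poly] stays in the class; its jet tends to that of [f] and is
    nondegenerate for small [t != 0]. *)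
Lemma nondegenerate_open_dense :
  open_dense_in (@jet2 R k.+1 @` @classV0 R k)
    [set J | nondegenerate_jet J /\ (@jet2 R k.+1 @` @classV0 R k) J].
Proof.
split.
  exists (nondeg_poly @^-1` [set r | r != 0]).
    apply: open_comp; last exact: open_neq.
    by move=> J _; exact: nondeg_poly_continuous.
  by apply/seteqP; split=> J [] ND SJ; split=> //; exact/nondegenerate_jetP.
move=> _ [f [[Sf f0] Df] <-] B nB.
have Sg := smooth_bump; have [g1 g00 gm0] := bump_jet.
pose F t := f + cst t * bump_poly.
have SF t : smooth (F t) by apply: smoothD => //; apply: smoothM => //; exact: smooth_cst.
have DF t : partial ord0 (F t) 0 = 0.
  rewrite partialD ?partial_scale//; last by apply: smoothM => //; exact: smooth_cst.
  have X0 j : X j 0 = 0 by rewrite /X mxE.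
  by rewrite partial_bump !fctE Df sources_dir0 !X0 !(addr0, mulr0).
have F0 t lam : F t (coord_vec 0 (fun=> 0) lam) = 0.
  rewrite /F !fctE f0 add0r coord_vecE !scale0r !add0r /bump_poly !fctE fct_sumE.
  have XE j : X j (lam *: delta_mx 0 ord_max) = lam * (j == ord_max)%:R by rewrite /X !mxE.
  rewrite XE /= mulr0 mul0r add0r big1 ?mulr0// => j _; rewrite !fctE XE.
  by have [->|_] := eqVneq j ord_max; rewrite ?sources_dir_max ?mul0r ?mulr0.
have JE t : jet2 (F t) = ((jet2 f).1 + t *: (jet2 bump_poly).1,
    (jet2 f).2 + t *: (jet2 bump_poly).2) := jet2_perturb t Sf Sg.
move: JE g1 g00 gm0 B nB; move: (jet2 f) (jet2 bump_poly) => J Q JE Q1 Q00 Qm0 B nB.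
have cF : (J.1 + t *: Q.1, J.2 + t *: Q.2) @[t --> (0 : R)] --> J.
  rewrite [X in _ --> X]surjective_pairing.
  by apply: cvg_pair_nbhs; exact: cvg_affine.
have nB' : \forall t \near 0^', B (J.1 + t *: Q.1, J.2 + t *: Q.2).
  by exact/nbhs_dnbhs/(cF _ nB).
have nND := perturb_nondegenerate J Q1 Q00 Qm0.
have [t [Bt NDt]] : exists t, B (J.1 + t *: Q.1, J.2 + t *: Q.2) /\
    nondegenerate_jet (J.1 + t *: Q.1, J.2 + t *: Q.2).
  by apply: (@filter_ex _ (0^' : set_system R)); near=> t; split; near: t.
exists (J.1 + t *: Q.1, J.2 + t *: Q.2); split => //; split => //.
by rewrite -JE; exists (F t).
Unshelve. all: by end_near. Qed.

End Generic.

(** * Proof of the proposition *)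

Section Main.
Variables (R : realType) (k : nat).
Implicit Types (f : 'rV[R]_k.+2 -> R).

Lemma derive_rescale f (s e : R) v x : smooth f ->
  'D_(e *: v) (cst s * f) x = s * e * 'D_v f x.
Proof.
move=> Sf; have dfx := smooth_differentiable x Sf.
have -> : cst s * f = s *: f by apply/funext => y; rewrite !fctE.
rewrite deriveE; last exact: differentiableZ.
have E : 'd f x (e *: v) = e * 'D_v f x by rewrite linearZ -deriveE.
by rewrite diffZ// -[LHS]/(s * 'd f x (e *: v)) E mulrA.
Qed.

Lemma unit_sign (x : R) : x != 0 -> exists s : R, s * s = 1 /\ 0 < s * x.
Proof.
by case: ltgtP => // x0 _; [exists (-1)|exists 1]; split; lra.
Qed.

Lemma sources_dir_neq0 : (0 < k)%N -> sources_dir R k != 0.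
Proof.
case: k => // k' _; apply/negP => /eqP/rowP/(_ (lift ord0 (lift ord_max ord0))).
by rewrite !mxE !liftK => /eqP; rewrite oner_eq0.
Qed.

Lemma classV0_origin f : classV0 f -> forall t : R, f (t *: delta_mx 0 ord_max) = 0.
Proof.
by move=> [[_ f0] _] t; have := f0 t; rewrite coord_vecE !scale0r !add0r.
Qed.

Lemma jet2_entry f i j : (jet2 f).2 i j = partial i (partial j f) 0.
Proof. by rewrite mxE. Qed.

Lemma derive_sources f : (0 < k)%N -> smooth f -> nondegenerate_jet (jet2 f) ->
  'D_(sources_dir R k) f 0 != 0.
Proof.
move=> k0 Sf [+ _ _]; rewrite /sources_sum (negbTE (sources_dir_neq0 k0)) add0r.
rewrite derive_partial; last exact: smooth_differentiable.
have E j : (jet2 f).1 0 j = partial j f 0 by rewrite mxE.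
by under eq_bigr do rewrite E.
Qed.

(* [ep] and [et] turn the signs of the derivatives of [f] into those required by
   [branch_chain]; the branch lives on the side [0 <= et * lam]. *)
Lemma signed_chain f n : (0 < k)%N -> classV0 f -> nondegenerate_jet (jet2 f) ->
  exists (ep et : R) (Y : nat -> R -> R) (l mu : R),
    [/\ ep * ep = 1 /\ et * et = 1, 0 < l /\ 0 < mu, Y 0 = cst 0,
      forall j, right_branch l (Y j)
    & forall t, 0 < t < l -> mu * t <= Y 1 t /\
        forall j, (j <= n)%N ->
          f (coord_vec (ep * Y j.+1 t) (fun=> ep * Y j t) (et * t)) = 0].
Proof.
move=> k0 Vf ND; have [[Sf _] Df] := Vf.
have DS := derive_sources k0 Sf ND.
pose e0 : 'rV[R]_k.+2 := delta_mx 0 ord0; pose em : 'rV[R]_k.+2 := delta_mx 0 ord_max.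
have [A0 B0] : 'D_e0 ('D_e0 f) 0 != 0 /\ 'D_em ('D_e0 f) 0 != 0.
  have [_ ] := ND; rewrite !jet2_entry /partial => A0 B0; split; [exact: A0|exact: B0].
have De0 : 'D_e0 f 0 = 0 by exact: Df.
have [s [ss sA]] := unit_sign A0.
have [s2 [ss2 sS]] := unit_sign DS.
have [s3 [ss3 sB]] := unit_sign B0.
(* With these signs [Daa = s * A], [Db = s * ep * S = - s2 * S] and
   [Dca = s * ep * et * B = - s3 * B]. *)
pose ep := - (s * s2); pose et := - (s * ep * s3).
have ep2 : ep * ep = 1 by rewrite /ep mulrNN mulrACA ss ss2 mulr1.
have et2 : et * et = 1 by rewrite /et mulrNN mulrACA ss3 mulr1 mulrACA ss ep2 mulr1.
pose f' : 'rV[R]_k.+2 -> R := cst s * f.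
have fE x : f' x = s * f x by [].
have Sf' : smooth f' by apply: smoothM => //; exact: smooth_cst.
have Sf0 : smooth ('D_e0 f) := smooth_derive e0 Sf.
have D1 v e x : 'D_(e *: v) f' x = s * e * 'D_v f x by exact: derive_rescale.
have DE : 'D_(ep *: e0) f' = cst (s * ep) * 'D_e0 f by apply/funext => x; exact: D1.
have D2 v e x : 'D_(e *: v) ('D_(ep *: e0) f') x = s * ep * e * 'D_v ('D_e0 f) x.
  by rewrite DE; exact: derive_rescale.
have [|||||Y [l [mu [l0 mu0 Y0 bY YP]]]] := @branch_chain R k.+1 f' (ep *: e0)
  (ep *: sources_dir R k) (et *: em) Sf' _ _ _ _ _ n.
- by move=> t; rewrite scalerA fE (classV0_origin Vf) mulr0.
- by rewrite D1 De0 mulr0.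
- by rewrite D2 -(mulrA s) ep2 mulr1.
- by rewrite D1 /ep mulrN mulrA ss mul1r mulNr oppr_lt0.
- rewrite D2 /et mulrN mulrA mulrACA ss ep2 !mul1r mulNr oppr_lt0.
  exact: sB.
exists ep, et, Y, l, mu; split=> // t tl; have [Y1 _ fY] := YP t tl; split=> // j /fY.
rewrite fE /curve !scalerA ![_ * ep]mulrC [t * et]mulrC -coord_vecE.
move=> /eqP; rewrite mulf_eq0 => /orP[/eqP sz|/eqP//].
by move: ss; rewrite sz mul0r => /esym/eqP; rewrite oner_eq0.
Qed.

Lemma unit_cases (et : R) : et * et = 1 -> et = 1 \/ et = -1.
Proof.
move=> et2; have /eqP : (et - 1) * (et + 1) = 0 by rewrite mulrDr mulrBl et2; ring.
by rewrite mulf_eq0 subr_eq0 addr_eq0 => /orP[/eqP|/eqP]; [left|right].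
Qed.

Lemma one_sided_scale (et l : R) : et * et = 1 -> 0 < l ->
  one_sided [set x | 0 <= et * x < l].
Proof.
move=> /unit_cases[->|->] l0; exists l => //; [right|left].
  by apply/seteqP; split=> x /=; rewrite in_itv /= mul1r.
by apply/seteqP; split=> x /=; rewrite in_itv /= => /andP[? ?]; apply/andP; split; lra.
Qed.

Lemma open_scale (et l : R) : open [set x | 0 < et * x < l].
Proof.
rewrite (_ : [set x | _] = ( *%R et) @^-1` `]0, l[%classic).
  apply: open_comp; last exact: interval_open.
  by move=> x _; exact: mulrl_continuous.
by apply/seteqP; split=> x /=; rewrite in_itv.
Qed.

Section Lifted.
Variables (N L : network k) (m n : nat) (ell : N -> nat) (ell' : L -> nat).
Hypotheses (hN : feed_forward m ell) (hL : feed_forward n ell').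

Lemma first_layer_vanishes f (b : branch R L) :
  (0 < k)%N -> classV0 f -> nondegenerate_jet (jet2 f) ->
  equilibrium_branch f b ->
  \forall lam \near 0, bdom b lam -> forall c : L, ell' c = 0%N -> b lam c = 0.
Proof.
move=> k0 Vf ND eb; have [[Sf _] Df] := Vf.
have DS := derive_sources k0 Sf ND.
pose e0 : 'rV[R]_k.+2 := delta_mx 0 ord0.
(* The equation of a first-layer cell lives on the diagonal, along which the derivative is
   [f_0 + S = S]. *)
have Dv : 'D_(e0 + sources_dir R k) f 0 != 0.
  rewrite deriveE; last exact: smooth_differentiable.
  rewrite linearD -!deriveE; try exact: smooth_differentiable.
  by rewrite (_ : 'D_e0 f 0 = 0) ?add0r.
have [e e_gt0 eP] := vanishing_of_derive Sf (classV0_origin Vf) Dv.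
have small : \forall lam \near 0, forall c : L, bdom b lam -> `|b lam c| < e.
  have small c : \forall lam \near 0, bdom b lam -> `|b lam c| < e.
    exact: equilibrium_small eb e_gt0.
  exact: filter_forall small.
near=> lam => Dlam c c0; have [_ _ fb] := eb.
have := fb lam Dlam c; rewrite /vector_field.
have -> : (fun i => b lam (src i c)) = fun=> b lam c.
  by apply/funext => i; rewrite (ff_src0 hL).
rewrite coord_vecE -scalerDr; apply: eP.
  by move: c Dlam {c0}; near: lam.
by near: lam; exact: near0_norm_lt.
Unshelve. all: by end_near. Qed.

Lemma inside_lifted f (b : branch R L) : classV0 f -> nondegenerate_jet (jet2 f) ->
  lift_inside_layer m n ell ell' 0 -> equilibrium_branch f b -> lifted_from N b.
Proof.
move=> Vf ND [[e [be eN]] mn _ cardE] eb; exists e; split => //.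
have [phi [phi_src e_phi _ phi_surj]] := lift_map be eN.
(* Without edge types, [L] consists of a single cell by connectedness. *)
have [k0|k0] := posnP k.
  near=> lam => _ c d _; congr (b lam _).
  by case: hL => _ _ _ _; apply: connected_no_edge.
have van := first_layer_vanishes k0 Vf ND eb.
near=> lam => Dlam c d /e_phi cd.
have zero : forall c : L, ell' c = 0%N -> b lam c = 0 by move: Dlam; near: lam.
have [|->|[c0 d0]] := lift_inside_inj hN hL phi_src phi_surj mn _ cd => //.
  by move=> j /andP[j0 jm]; apply: cardE => // j0'; rewrite j0' in j0.
by rewrite !zero.
Unshelve. all: by end_near. Qed.

Lemma created_branch f : (m < n)%N -> classV0 f -> nondegenerate_jet (jet2 f) ->
  exists b : branch R L, bifurcation_branch f b /\ ~ lifted_from N b.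
Proof.
move=> mn Vf ND; have n0 : (0 < n)%N := leq_ltn_trans (leq0n m) mn.
have [i _] := ff_edge hL n0; have k0 : (0 < k)%N := leq_ltn_trans (leq0n i) (ltn_ord i).
have [c1 c1E] := ff_layer hL n0.
have [ep [et [Y [l [mu [[ep2 et2] [l0 mu0] Y0 bY YP]]]]]] := signed_chain n k0 Vf ND.
(* The state of a cell depends only on its layer; [et] selects the side of [0] on which the branch
   lives. *)
pose b := @Branch R k L [set x | 0 <= et * x < l] (fun lam c => ep * Y (ell' c) (et * lam)).
have bE lam c : b lam c = ep * Y (ell' c) (et * lam) by [].
have et0 : et != 0.
  by apply: contra_eq_neq et2 => ->; rewrite mul0r eq_sym oner_eq0.
have ep0 : ep != 0.
  by apply: contra_eq_neq ep2 => ->; rewrite mul0r eq_sym oner_eq0.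
have etK x : et * (et * x) = x by rewrite mulrA et2 mul1r.
have Y00 j : Y j 0 = 0 by have [_ -> //] := bY j.
have os : one_sided (bdom b) := one_sided_scale et2 l0.
have norm1 (s : R) : s * s = 1 -> `|s| = 1.
  by move=> /unit_cases[->|->]; rewrite ?normrN normr1.
have eb : equilibrium_branch f b.
  split.
  - right; split=> // c; have [cY _ CY] := bY (ell' c); split.
      apply: continuous_in_subspaceT => x; rewrite inE /= => /andP[_ xl].
      apply: cvgM; first exact: cvg_cst.
      apply: (@continuous_comp _ _ _ ( *%R et) (Y (ell' c))); first exact: mulrl_continuous.
      exact: cY.
    rewrite (_ : bdom b `\ 0 = [set x | 0 < et * x < l]).
      apply: Cr_on_smooth; first exact: open_scale.
      move=> r; apply: Cr_onM; first exact: Cr_on_cst.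
      by apply: Cr_on_scale (CY r) => x /=; rewrite in_itv.
    apply/seteqP; split=> x /=.
      move=> [/andP[x0 ->] /eqP xN0]; rewrite andbT lt_neqAle x0 andbT eq_sym.
      by rewrite mulf_neq0.
    move=> /andP[x0 ->]; rewrite ltW//; split => // xE.
    by rewrite xE mulr0 ltxx in x0.
  - by move=> c; rewrite bE mulr0 Y00 mulr0.
  - move=> lam Dlam c; rewrite /vector_field.
    have /andP[lam0 laml] : 0 <= et * lam < l := Dlam.
    have zero : f (coord_vec 0 (fun=> 0) lam) = 0 by have [[_ ->]] := Vf.
    move: lam0; rewrite le_eqVlt => /orP[/eqP lamE|lam0].
      rewrite bE -lamE Y00 mulr0.
      rewrite (_ : (fun i => b lam (src i c)) = fun=> 0)//.
      by apply/funext => j; rewrite bE -lamE Y00 mulr0.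
    have [|_ fY] := YP (et * lam); first by rewrite lam0.
    case cE : (ell' c) => [|j].
      rewrite bE cE Y0 mulr0 (_ : (fun i => b lam (src i c)) = fun=> 0)//.
      by apply/funext => j; rewrite bE (ff_src0 hL)// cE Y0 mulr0.
    have := fY j; rewrite etK bE cE => <-; last by have := ff_le hL c; rewrite cE => /ltnW.
    rewrite (_ : (fun i => b lam (src i c)) = fun=> ep * Y j (et * lam))//.
    by apply/funext => i'; rewrite bE (ff_srcS hL _ cE).
have grows : linear_growth c1 b.
  exists mu => //; near=> lam => Dlam; have /andP[lam0 laml] : 0 <= et * lam < l := Dlam.
  rewrite bE c1E normrM (norm1 _ ep2) mul1r.
  have -> : `|lam| = `|et * lam| by rewrite normrM (norm1 _ et2) mul1r.
  rewrite (ger0_norm lam0); apply: le_trans (ler_norm _).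
  move: lam0; rewrite le_eqVlt => /orP[/eqP <-|lam0]; first by rewrite Y00 mulr0.
  by have [|-> //] := YP (et * lam); rewrite ?lam0.
exists b; split; first by split => //; exact: linear_growth_nontrivial grows.
move=> [e [be eN /near0_lt[d d0 dP]]].
have [phi [phi_src _ phi_e _]] := lift_map be eN.
have ec : e (src i c1) c1 by apply: phi_e; exact: (layer1_collapse hN hL phi_src i mn c1E).
(* At [lam = et * t] the coloring would force the states of [c1] and its source to agree, but the
   source is at [0] while [Y 1 t >= mu * t > 0]. *)
pose t := Num.min d l / 2.
have min0 : 0 < Num.min d l by rewrite lt_min d0.
have t0 : 0 < t by rewrite divr_gt0.
have tmin : t < Num.min d l by rewrite ltr_pdivrMr// ltr_pMr// ltr1n.
move: (tmin); rewrite lt_min => /andP[td tl].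
have := dP (et * t); rewrite normrM (norm1 _ et2) mul1r gtr0_norm// => /(_ td).
have Dt : bdom b (et * t) by rewrite /= etK ltW.
move=> /(_ Dt _ _ ec) /eqP; rewrite !bE etK.
rewrite (ff_srcS hL _ c1E) c1E Y0 mulr0 eq_sym mulf_eq0 (negbTE ep0) /=.
have [|Y1 _] := YP t; first by rewrite t0.
by rewrite gt_eqF// (lt_le_trans _ Y1)// mulr_gt0.
Unshelve. all: by end_near. Qed.

End Lifted.
End Main.

Theorem proposition6p3 (R : realType) (k : nat) (N : network k) (m : nat)
    (ell : N -> nat) (hN : feed_forward m ell) :
  generic (@classV0 R k) (fun f =>
    forall (L : network k) (n : nat) (ell' : L -> nat),
      feed_forward n ell' -> is_lift L N ->
      (lift_inside_layer m n ell ell' 0 ->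
         forall b : branch R L, bifurcation_branch f b -> lifted_from N b)
      /\
      (lift_creating_layers m n ell ell' ->
         exists b : branch R L,
           bifurcation_branch f b /\ ~ lifted_from N b)).
Proof.
(* This set depends only on [k], so one choice serves all lifts [L] at once. *)
exists [set J | nondegenerate_jet J /\ (@jet2 R k.+1 @` @classV0 R k) J].
  exact: nondegenerate_open_dense.
move=> f Vf [ND _] L n ell' hL _; split.
  by move=> inside b [eb _]; exact: (inside_lifted hN hL Vf ND inside eb).
by move=> [_ mn _ _]; exact: (created_branch hN hL mn Vf ND).
Qed.
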